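(* Let $z\in[0,1]$. Then $z$ is weakly $2$-random if and only if every computable function $f\colon[0,1]\to\mathbb R$ that is differentiable at almost every point (with respect to Lebesgue measure) is differentiable at $z$.
   Context: A Cauchy name for a real $x$ is a sequence of rationals $(q_n)$ with $|q_n-q_{n-1}|\le2^{-n}$ for $n>0$ and $\lim_nq_n=x$; reals and sequences of reals are computable if they have (uniformly) computable Cauchy names. $f\colon[0,1]\to\mathbb R$ is computable if it maps computable sequences of reals in $[0,1]$ to computable sequences of reals, and there is a computable $h\colon\mathbb N\to\mathbb N$ with $|x-y|<2^{-h(n)}\Rightarrow|f(x)-f(y)|<2^{-n}$. An open interval in $[0,1]$ means a set of the form $(a,b)$, $[0,b)$, $(a,1]$ or $[0,1]$ with $0\le a\le b\le1$. A $\Sigma^0_1$ set in $[0,1]$ is a set $\bigcup_kA_k$ where $(A_k)$ is a computable sequence of open intervals in $[0,1]$ with dyadic rational endpoints; a $\Pi^0_2$ set is $\bigcap_m\mathcal G_m$ where the $\mathcal G_m$ are $\Sigma^0_1$ sets uniformly in $m$. A real $z\in[0,1]$ is weakly $2$-random if it belongs to no $\Pi^0_2$ set of Lebesgue measure zero. *)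

(* Defs.v *)
From HB Require Import structures.
From mathcomp Require Import all_boot all_order all_algebra.
From mathcomp Require Import all_classical all_reals all_analysis.

Set Implicit Arguments.
Unset Strict Implicit.
Unset Printing Implicit Defensive.

Import Order.TTheory GRing.Theory Num.Theory.
Import numFieldNormedType.Exports.

Local Open Scope classical_set_scope.
Local Open Scope ring_scope.

(* Programs for the partial mu-recursive functions. The evaluation relation    *)
(* below is partial: a program need not return a value on a given argument     *)
(* list (unbounded search, or too few arguments).                              *)
Inductive murec : Type :=
| MZero
| MSucc
| MProj of nat
| MComp of murec & seq murec
| MPrec of murec & murec
| MMin of murec.

Inductive murec_eval : murec -> seq nat -> nat -> Prop :=
| eval_zero v : murec_eval MZero v 0
| eval_succ x v : murec_eval MSucc (x :: v) x.+1
| eval_proj i v : (i < size v)%N -> murec_eval (MProj i) v (nth 0%N v i)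
| eval_comp c cs v w y :
    murec_evals cs v w -> murec_eval c w y -> murec_eval (MComp c cs) v y
| eval_prec0 c d v y :
    murec_eval c v y -> murec_eval (MPrec c d) (0%N :: v) y
| eval_precS c d n v r y :
    murec_eval (MPrec c d) (n :: v) r -> murec_eval d [:: n, r & v] y ->
    murec_eval (MPrec c d) (n.+1 :: v) y
| eval_min c v n (k : nat -> nat) :
    murec_eval c (n :: v) 0 ->
    (forall m, (m < n)%N -> murec_eval c (m :: v) (k m).+1) ->
    murec_eval (MMin c) v n
with murec_evals : seq murec -> seq nat -> seq nat -> Prop :=
| evals_nil v : murec_evals [::] v [::]
| evals_cons c cs v y w :
    murec_eval c v y -> murec_evals cs v w ->
    murec_evals (c :: cs) v (y :: w).

Definition computable1 (f : nat -> nat) : Prop :=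
  exists c, forall n, murec_eval c [:: n] (f n).

Definition computable2 (f : nat -> nat -> nat) : Prop :=
  exists c, forall m n, murec_eval c [:: m; n] (f m n).

Definition computable_rat2 (q : nat -> nat -> rat) : Prop :=
  exists s a b : nat -> nat -> nat,
    [/\ computable2 s, computable2 a, computable2 b &
        forall k n, q k n = (-1) ^+ s k n * (a k n)%:R / (b k n).+1%:R].

Definition cauchy_name (R : realType) (q : nat -> rat) (x : R) : Prop :=
  (forall n, (0 < n)%N -> `|q n - q n.-1| <= 2 ^- n) /\
  (ratr (q n) : R) @[n --> \oo] --> x.

Definition computable_realseq (R : realType) (x : nat -> R) : Prop :=
  exists q : nat -> nat -> rat,
    computable_rat2 q /\ forall k, cauchy_name (q k) (x k).

(* Functions [0,1] -> R are represented by functions R -> R of which only the  *)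
(* values on [0,1] are ever used.                                              *)
Definition computable_fun01 (R : realType) (f : R -> R) : Prop :=
  (forall x : nat -> R, (forall k, x k \in `[0, 1]) ->
     computable_realseq x -> computable_realseq (fun k => f (x k))) /\
  exists2 h : nat -> nat, computable1 h &
    forall (n : nat) (x y : R), x \in `[0, 1] -> y \in `[0, 1] ->
      `|x - y| < 2 ^- h n -> `|f x - f y| < 2 ^- n.

(* The difference quotient is taken over points of [0,1] only; at 0 and 1 this *)
(* is the one-sided derivative.                                                *)
Definition differentiable01 (R : realType) (f : R -> R) (z : R) : Prop :=
  exists l : R,
    (f y - f z) / (y - z)
      @[y --> within [set y | y \in `[0, 1] /\ y != z] (nbhs z)] --> l.

Definition dyadic (R : realType) (p e : nat) : R := p%:R / 2 ^+ e.

Definition open_interval01 (R : realType) (t : nat) (a b : R) : set R :=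
  match t with
  | 0 => [set` `]a, b[]
  | 1 => [set` `[0, b[]
  | 2 => [set` `]a, 1]]
  | _ => [set` `[0, 1]]
  end.

(* G m = \bigcup_k A m k for a computable double sequence of intervals; A m k  *)
(* is given by its shape t m k and by its endpoints as pairs of a numerator    *)
(* and an exponent of 2.                                                       *)
Definition uniformly_Sigma01 (R : realType) (G : nat -> set R) : Prop :=
  exists t p d q e : nat -> nat -> nat,
    [/\ [/\ computable2 t, computable2 p, computable2 d, computable2 q &
            computable2 e],
        forall m k, [/\ 0 <= dyadic R (p m k) (d m k),
          dyadic R (p m k) (d m k) <= dyadic R (q m k) (e m k) &
          dyadic R (q m k) (e m k) <= 1] &
        forall m, G m = \bigcup_k open_interval01 (t m k)
          (dyadic R (p m k) (d m k)) (dyadic R (q m k) (e m k))].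

Definition Pi02 (R : realType) (S : set R) : Prop :=
  exists2 G : nat -> set R, uniformly_Sigma01 G & S = \bigcap_m G m.

Definition weakly2random (R : realType) (z : R) : Prop :=
  z \in `[0, 1] /\
  forall S : set R, Pi02 S -> lebesgue_measure S = 0%E -> ~ S z.

(* Main.v *)
Require Import Defs.
From HB Require Import structures.
From mathcomp Require Import all_boot all_order all_algebra.
From mathcomp Require Import all_classical all_reals all_analysis.
From mathcomp Require Import zify ring lra.

(**
Non-differentiability of [f] at an interior point [z] means that, for some [k],
there are arbitrarily short pairs of chords straddling [z], with dyadic end
points, whose slopes differ by more than [2^-k].  For fixed [k] this is a Pi02
condition on [z], and it defines a null set when [f] is differentiable almost
everywhere; so a weakly 2-random point avoids it.

Conversely, let [z] lie in a null Pi02 set, the intersection of the [G m].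
Walk down the 4-adic intervals containing a point [x] and keep a level [m],
initially [0].  When the interval of length [4^-n], fattened by [2^-n], is
seen at stage [n] to be contained in [G m], add to [f] the tent of slope [+-1]
on that interval and increase the level.  If [x] is in all [G m] then
infinitely many tents are added above [x], each changing the slope of a chord
around [x] by one, and [f] is not differentiable at [x].  If [x] is not in
[G m] then only finitely many tents are added above [x] (at a point [x] which
is not 4-adic), and a later tent near [x] of height at most [4^-n] is at
distance at least [2^-n] from [x], so that [f] is affine at [x] up to a
quadratic error.
*)

Set Implicit Arguments.
Unset Strict Implicit.
Unset Printing Implicit Defensive.

Import Order.TTheory GRing.Theory Num.Theory.
Import numFieldNormedType.Exports.

Local Open Scope classical_set_scope.
Local Open Scope ring_scope.

(** * Recursive functions *)

Section RecursiveFunctions.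
Local Open Scope nat_scope.

(** All arities are handled at once by functions of an argument list, of which only the values on
    lists of length [k] matter; closure properties can then be stated pointwise, without
    currying. *)
Definition rec_fun (k : nat) (f : seq nat -> nat) : Prop :=
  exists c, forall v, size v = k -> murec_eval c v (f v).

Lemma eq_rec_fun k f g :
  (forall v, f v = g v) -> rec_fun k f -> rec_fun k g.
Proof. by move=> fg [c fc]; exists c => v sv; rewrite -fg; apply: fc. Qed.

Lemma rec_fun_nth k i : i < k -> rec_fun k (fun v => nth 0 v i).
Proof. by move=> ik; exists (MProj i) => v sv; apply: eval_proj; rewrite sv. Qed.

Lemma rec_fun_succ k f : rec_fun k f -> rec_fun k (fun v => (f v).+1).
Proof.
move=> [c fc]; exists (MComp MSucc [:: c]) => v sv.
apply: (@eval_comp _ _ _ [:: f v]); last exact: eval_succ.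
by apply: evals_cons; [exact: fc|exact: evals_nil].
Qed.

Lemma rec_fun_cst k n : rec_fun k (fun=> n).
Proof.
elim: n => [|n IHn]; first by exists MZero => v _; apply: eval_zero.
exact: rec_fun_succ IHn.
Qed.

Lemma rec_fun_comp1 k g f :
  computable1 g -> rec_fun k f -> rec_fun k (fun v => g (f v)).
Proof.
move=> [d gd] [c fc]; exists (MComp d [:: c]) => v sv.
apply: (@eval_comp _ _ _ [:: f v]); last exact: gd.
by apply: evals_cons; [exact: fc|exact: evals_nil].
Qed.

Lemma rec_fun_comp2 k g f1 f2 : computable2 g ->
  rec_fun k f1 -> rec_fun k f2 -> rec_fun k (fun v => g (f1 v) (f2 v)).
Proof.
move=> [d gd] [c1 fc1] [c2 fc2]; exists (MComp d [:: c1; c2]) => v sv.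
apply: (@eval_comp _ _ _ [:: f1 v; f2 v]); last exact: gd.
by do 2?[apply: evals_cons; first by auto]; exact: evals_nil.
Qed.

(** Projections from position [m] on copy the tail of the argument list; this is how parameters are
    handed to a subprogram. *)
Lemma murec_evals_nth m (s v : seq nat) :
  size v = m + size s -> drop m v = s ->
  murec_evals [seq MProj i | i <- iota m (size s)] v s.
Proof.
elim: s m => [|x s IHs] m /= sv dv; first exact: evals_nil.
have mv : m < size v by rewrite sv addnS leq_addr.
move: dv; rewrite (drop_nth 0) // => -[<- dv].
apply: evals_cons; first exact: eval_proj.
by apply: IHs => //; rewrite sv addSnnS.
Qed.

Lemma rec_fun_drop j k f : rec_fun k f -> rec_fun (j + k) (fun w => f (drop j w)).
Proof.
move=> [c fc]; exists (MComp c [seq MProj i | i <- iota j k]) => w sw.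
have sd : size (drop j w) = k by rewrite size_drop sw addKn.
apply: (@eval_comp _ _ _ (drop j w)); last exact: fc.
by rewrite -{1}sd; apply: murec_evals_nth; rewrite ?sd.
Qed.

(** The step program receives the counter, the previous value and then the parameters, hence
    [drop 2]. Most arithmetic below is obtained from this recursion. *)
Lemma rec_fun_rec k n g (h : nat -> nat -> seq nat -> nat) :
  rec_fun k n -> rec_fun k g ->
  rec_fun k.+2 (fun w => h (nth 0 w 0) (nth 0 w 1) (drop 2 w)) ->
  rec_fun k (fun v => nat_rect (fun=> nat) (g v) (fun i r => h i r v) (n v)).
Proof.
move=> [cn fn] [cg fg] [ch fh].
exists (MComp (MPrec cg ch) (cn :: [seq MProj i | i <- iota 0 k])) => v sv.
apply: (@eval_comp _ _ _ (n v :: v)).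
  apply: evals_cons; first exact: fn.
  by rewrite -sv; apply: murec_evals_nth; rewrite ?drop0.
elim: (n v) => [|i IHi] /=; first by apply: eval_prec0; exact: fg.
apply: eval_precS IHi _.
by have := fh [:: i, nat_rect (fun=> nat) (g v) (fun i r => h i r v) i & v];
  rewrite /= drop0 sv; apply.
Qed.

Lemma computable1P f :
  computable1 f <-> rec_fun 1 (fun v => f (nth 0 v 0)).
Proof.
split=> [cf|[c fc]]; first by apply: rec_fun_comp1 => //; exact: rec_fun_nth.
by exists c => n; apply: (fc [:: n]).
Qed.

Lemma computable2P f :
  computable2 f <-> rec_fun 2 (fun v => f (nth 0 v 0) (nth 0 v 1)).
Proof.
split=> [cf|[c fc]]; first by apply: rec_fun_comp2 => //; exact: rec_fun_nth.
by exists c => m n; apply: (fc [:: m; n]).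
Qed.

Section Closure.
Variables (k : nat) (f g : seq nat -> nat).
Hypotheses (cf : rec_fun k f) (cg : rec_fun k g).

Lemma rec_fun_add : rec_fun k (fun v => f v + g v).
Proof.
apply: eq_rec_fun (rec_fun_rec (h := fun _ r _ => r.+1) cf cg _) => [v|].
  by elim: (f v) => //= n ->.
exact/rec_fun_succ/rec_fun_nth.
Qed.

Lemma rec_fun_pred : rec_fun k (fun v => (f v).-1).
Proof.
apply: eq_rec_fun
  (rec_fun_rec (h := fun i _ _ => i) cf (rec_fun_cst k 0) _) => [v|].
  by case: (f v).
exact: rec_fun_nth.
Qed.

End Closure.

Section ClosureSub.
Variables (k : nat) (f g : seq nat -> nat).
Hypotheses (cf : rec_fun k f) (cg : rec_fun k g).

Lemma rec_fun_sub : rec_fun k (fun v => f v - g v).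
Proof.
apply: eq_rec_fun (rec_fun_rec (h := fun _ r _ => r.-1) cg cf _) => [v|].
  by elim: (g v) => [|n /= ->]; rewrite ?subn0 ?subnS.
exact/rec_fun_pred/rec_fun_nth.
Qed.

Lemma rec_fun_mul : rec_fun k (fun v => f v * g v).
Proof.
apply: eq_rec_fun
  (rec_fun_rec (h := fun _ r v => g v + r) cf (rec_fun_cst k 0) _) => [v|].
  by elim: (f v) => [|n /= ->] //; rewrite mulSn.
by apply: rec_fun_add; [exact: (rec_fun_drop 2)|exact: rec_fun_nth].
Qed.

End ClosureSub.

Section ClosureExp.
Variables (k : nat) (f g : seq nat -> nat).
Hypotheses (cf : rec_fun k f) (cg : rec_fun k g).

Lemma rec_fun_exp : rec_fun k (fun v => f v ^ g v).
Proof.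
apply: eq_rec_fun
  (rec_fun_rec (h := fun _ r v => f v * r) cg (rec_fun_cst k 1) _) => [v|].
  by elim: (g v) => [|n /= ->] //; rewrite expnS.
by apply: rec_fun_mul; [exact: (rec_fun_drop 2)|exact: rec_fun_nth].
Qed.

Lemma rec_fun_leq : rec_fun k (fun v => f v <= g v : nat).
Proof.
apply: eq_rec_fun (rec_fun_sub (rec_fun_cst k 1) (rec_fun_sub cf cg)) => v.
by rewrite /leq; case: (f v - g v) => // n; rewrite subSS sub0n.
Qed.

Lemma rec_fun_min : rec_fun k (fun v => minn (f v) (g v)).
Proof.
by apply: eq_rec_fun (rec_fun_sub cf (rec_fun_sub cf cg)) => v; rewrite minnE.
Qed.

Lemma rec_fun_max : rec_fun k (fun v => maxn (f v) (g v)).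
Proof.
by apply: eq_rec_fun (rec_fun_add cf (rec_fun_sub cg cf)) => v; rewrite maxnE.
Qed.

Lemma rec_fun_odd : rec_fun k (fun v => odd (f v) : nat).
Proof.
apply: eq_rec_fun
  (rec_fun_rec (h := fun _ r v => 1 - r) cf (rec_fun_cst k 0) _) => [v|].
  by elim: (f v) => [|n /= ->] //; case: (odd n).
by apply: rec_fun_sub; [exact: rec_fun_cst|exact: rec_fun_nth].
Qed.

End ClosureExp.

Lemma rec_fun_ltn k f g : rec_fun k f -> rec_fun k g ->
  rec_fun k (fun v => f v < g v : nat).
Proof. by move=> /rec_fun_succ; apply: rec_fun_leq. Qed.

Lemma rec_fun_and k (a b : seq nat -> bool) :
  rec_fun k (fun v => a v : nat) -> rec_fun k (fun v => b v : nat) ->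
  rec_fun k (fun v => a v && b v : nat).
Proof.
by move=> ca cb; apply: eq_rec_fun (rec_fun_mul ca cb) => v; case: (a v);
  rewrite ?mul1n ?mul0n.
Qed.

Lemma rec_fun_neg k (a : seq nat -> bool) :
  rec_fun k (fun v => a v : nat) -> rec_fun k (fun v => ~~ a v : nat).
Proof.
by move=> ca; apply: eq_rec_fun (rec_fun_sub (rec_fun_cst k 1) ca) => v;
  case: (a v).
Qed.

Lemma rec_fun_or k (a b : seq nat -> bool) :
  rec_fun k (fun v => a v : nat) -> rec_fun k (fun v => b v : nat) ->
  rec_fun k (fun v => a v || b v : nat).
Proof.
move=> ca cb.
apply: eq_rec_fun (rec_fun_neg (rec_fun_and (rec_fun_neg ca) (rec_fun_neg cb))).
by move=> v; rewrite negb_and !negbK.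
Qed.

Lemma rec_fun_if k (a : seq nat -> bool) f g :
  rec_fun k (fun v => a v : nat) -> rec_fun k f -> rec_fun k g ->
  rec_fun k (fun v => if a v then f v else g v).
Proof.
move=> ca cf cg; apply: eq_rec_fun
  (rec_fun_add (rec_fun_mul ca cf) (rec_fun_mul (rec_fun_neg ca) cg)) => v.
by case: (a v); rewrite ?mul1n ?mul0n ?addn0.
Qed.

(** Recursion on the dividend: the quotient [r] grows by one exactly when [r.+1] times the divisor
    fits into the next dividend. *)
Lemma rec_fun_divnS k f g : rec_fun k f -> rec_fun k g ->
  rec_fun k (fun v => f v %/ (g v).+1).
Proof.
move=> cf cg; apply: eq_rec_fun
  (rec_fun_rec (h := fun i r v => r + (r.+1 * (g v).+1 <= i.+1))
    cf (rec_fun_cst k 0) _) => [v|].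
  elim: (f v) => [|n /= ->]; first by rewrite div0n.
  rewrite divnS // [RHS]addnC; congr (_ + nat_of_bool _).
  set d := (g v).+1; have := divn_eq n.+1 d; have := divn_eq n d.
  have := ltn_pmod n (isT : 0 < d); have := ltn_pmod n.+1 (isT : 0 < d).
  rewrite divnS // /dvdn; case: eqP => [->|] /=; nia.
apply: rec_fun_add; first exact: rec_fun_nth.
apply: rec_fun_leq; last exact/rec_fun_succ/rec_fun_nth.
apply: rec_fun_mul; first exact/rec_fun_succ/rec_fun_nth.
exact/rec_fun_succ/(rec_fun_drop 2).
Qed.

Lemma rec_fun_sum k n (h : nat -> seq nat -> nat) :
  rec_fun k n -> rec_fun k.+1 (fun w => h (nth 0 w 0) (drop 1 w)) ->
  rec_fun k (fun v => \sum_(i < n v) h i v).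
Proof.
move=> cn [c hc]; apply: eq_rec_fun
  (rec_fun_rec (h := fun i r v => r + h i v) cn (rec_fun_cst k 0) _) => [v|].
  by elim: (n v) => [|m /= ->]; rewrite ?big_ord0 ?big_ord_recr.
apply: rec_fun_add; first exact: rec_fun_nth.
(* The projections skip position 1, which holds the partial sum. *)
exists (MComp c (MProj 0 :: [seq MProj i | i <- iota 2 k])) => w sw.
have sd : size (drop 2 w) = k by rewrite size_drop sw subn2.
apply: (@eval_comp _ _ _ (nth 0 w 0 :: drop 2 w)).
  apply: evals_cons; first by apply: eval_proj; rewrite sw.
  by rewrite -{1}sd; apply: murec_evals_nth; rewrite ?sd.
by have := hc (nth 0 w 0 :: drop 2 w); rewrite /= drop0 sd; apply.
Qed.

Lemma rec_fun_exists k n (h : nat -> seq nat -> bool) :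
  rec_fun k n -> rec_fun k.+1 (fun w => h (nth 0 w 0) (drop 1 w) : nat) ->
  rec_fun k (fun v => [exists i : 'I_(n v), h i v] : nat).
Proof.
move=> cn ch; apply: eq_rec_fun (rec_fun_ltn (rec_fun_cst k 0)
  (rec_fun_sum (h := fun i v => h i v : nat) cn ch)) => v.
congr nat_of_bool; apply/idP/existsP => [|[i hi]].
  rewrite lt0n sum_nat_eq0 => /forallPn [i].
  by rewrite negb_imply eqb0 negbK => /andP[_ hi]; exists i.
by rewrite (bigD1 i) //= hi.
Qed.

(** The code lies between the squares of [x + y] and [(x + y).+1], so its integer square root is
    [x + y] and the remainder is [x]. The pairing is injective but not onto. *)
Definition npair (x y : nat) : nat := (x + y) ^ 2 + x.
Definition nsqrt (n : nat) : nat := \sum_(i < n) (i.+1 ^ 2 <= n).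
Definition nfst (n : nat) : nat := n - nsqrt n ^ 2.
Definition nsnd (n : nat) : nat := nsqrt n - nfst n.

Lemma nsqrtE (s n : nat) : s ^ 2 <= n -> n < s.+1 ^ 2 -> nsqrt n = s.
Proof.
move=> sn ns; have lesn : s <= n by nia.
rewrite /nsqrt (eq_bigr (fun i : 'I_n => (i < s) : nat)); last first.
  move=> i _; congr nat_of_bool; apply/idP/idP => [h|h]; first nia.
  by rewrite (leq_trans _ sn) // leq_exp2r.
by rewrite -big_mkcond /= (big_ord_narrow lesn) /= sum1_card card_ord.
Qed.

Lemma nsqrt_npair x y : nsqrt (npair x y) = x + y.
Proof. by apply: nsqrtE; rewrite /npair; nia. Qed.

Lemma npairK1 x y : nfst (npair x y) = x.
Proof. by rewrite /nfst nsqrt_npair /npair addKn. Qed.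

Lemma npairK2 x y : nsnd (npair x y) = y.
Proof. by rewrite /nsnd npairK1 nsqrt_npair addKn. Qed.

Section ClosurePair.
Variables (k : nat) (f g : seq nat -> nat).
Hypotheses (cf : rec_fun k f) (cg : rec_fun k g).

Lemma rec_fun_npair : rec_fun k (fun v => npair (f v) (g v)).
Proof.
by apply/rec_fun_add/cf/rec_fun_exp/rec_fun_cst/rec_fun_add.
Qed.

Lemma rec_fun_nsqrt : rec_fun k (fun v => nsqrt (f v)).
Proof.
apply: (rec_fun_sum (h := fun i v => i.+1 ^ 2 <= f v)) => //.
apply: rec_fun_leq; last exact: (rec_fun_drop 1).
by apply: rec_fun_exp; [exact/rec_fun_succ/rec_fun_nth|exact: rec_fun_cst].
Qed.

Lemma rec_fun_nfst : rec_fun k (fun v => nfst (f v)).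
Proof.
apply: rec_fun_sub => //; apply: rec_fun_exp; last exact: rec_fun_cst.
exact: rec_fun_nsqrt.
Qed.

Lemma rec_fun_nsnd : rec_fun k (fun v => nsnd (f v)).
Proof. exact/(rec_fun_sub rec_fun_nsqrt)/rec_fun_nfst. Qed.

End ClosurePair.

Lemma rec_fun_nth_drop j k i : j + i < k ->
  rec_fun k (fun w => nth 0 (drop j w) i).
Proof.
move=> jik; apply: eq_rec_fun (rec_fun_nth jik) => w; exact/esym/nth_drop.
Qed.

End RecursiveFunctions.

(** Closure lemmas are chosen by the head symbol of the body; the [drop] cases reach parameters from
    below a bounded sum or a recursion. Unrecognized goals are left open. *)
Ltac rec_fun_tac :=
  try assumption;
  lazymatch goal with
  | |- rec_fun _ (fun _ => ?n) => apply: rec_fun_cst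
  | |- rec_fun _ (fun v => nth 0%N v ?i) => by apply: rec_fun_nth
  | |- rec_fun _ (fun v => nth 0%N (drop ?j v) ?i) => by apply: rec_fun_nth_drop
  | |- rec_fun _ (fun v => _ (drop ?j v)) => by apply: (rec_fun_drop j)
  | |- rec_fun ?k (fun v => S (@?f v)) =>
      apply: (@rec_fun_succ k f); rec_fun_tac
  | |- rec_fun ?k (fun v => predn (@?f v)) =>
      apply: (@rec_fun_pred k f); rec_fun_tac
  | |- rec_fun ?k (fun v => addn (@?f v) (@?g v)) =>
      apply: (@rec_fun_add k f g); rec_fun_tac
  | |- rec_fun ?k (fun v => subn (@?f v) (@?g v)) =>
      apply: (@rec_fun_sub k f g); rec_fun_tac
  | |- rec_fun ?k (fun v => muln (@?f v) (@?g v)) =>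
      apply: (@rec_fun_mul k f g); rec_fun_tac
  | |- rec_fun ?k (fun v => expn (@?f v) (@?g v)) =>
      apply: (@rec_fun_exp k f g); rec_fun_tac
  | |- rec_fun ?k (fun v => divn (@?f v) (S (@?g v))) =>
      apply: (@rec_fun_divnS k f g); rec_fun_tac
  | |- rec_fun ?k (fun v => minn (@?f v) (@?g v)) =>
      apply: (@rec_fun_min k f g); rec_fun_tac
  | |- rec_fun ?k (fun v => maxn (@?f v) (@?g v)) =>
      apply: (@rec_fun_max k f g); rec_fun_tac
  | |- rec_fun ?k (fun v => npair (@?f v) (@?g v)) =>
      apply: (@rec_fun_npair k f g); rec_fun_tac
  | |- rec_fun ?k (fun v => nfst (@?f v)) =>
      apply: (@rec_fun_nfst k f); rec_fun_tac
  | |- rec_fun ?k (fun v => nsnd (@?f v)) =>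
      apply: (@rec_fun_nsnd k f); rec_fun_tac
  | |- rec_fun ?k (fun v => nat_of_bool (odd (@?f v))) =>
      apply: (@rec_fun_odd k f); rec_fun_tac
  | |- rec_fun ?k (fun v => nat_of_bool (@?a v && @?b v)) =>
      apply: (@rec_fun_and k a b); rec_fun_tac
  | |- rec_fun ?k (fun v => nat_of_bool (@?a v || @?b v)) =>
      apply: (@rec_fun_or k a b); rec_fun_tac
  | |- rec_fun ?k (fun v => nat_of_bool (leq (@?f v) (@?g v))) =>
      apply: (@rec_fun_leq k f g); rec_fun_tac
  | |- rec_fun ?k (fun v => ?h (@?f v) (@?g v)) =>
      apply: (@rec_fun_comp2 k h f g); [by []|rec_fun_tac|rec_fun_tac]
  | _ => idtac
  end.

(** * Differentiability and chords *)

Section Real.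
Variable R : realType.
Implicit Types (f : R -> R) (x y z a b l : R).

Lemma exp2V_gt0 n : 0 < 2 ^- n :> R.
Proof. by rewrite invr_gt0 exprn_gt0. Qed.

Lemma exp2V_lt (e : R) : 0 < e -> exists n, 2 ^- n < e.
Proof.
move=> e0; have := @cvg_geometric R 1 2^-1.
rewrite ger0_norm ?invr_ge0// => /(_ _)/cvgrPdist_lt/(_ e e0).
case; first lra.
move=> n _ /(_ n (leqnn n)) /=; rewrite mul1r sub0r normrN exprVn.
by rewrite ger0_norm ?(ltW (exp2V_gt0 n))// => h; exists n.
Qed.

Lemma exp2V_le m n : (m <= n)%N -> 2 ^- n <= 2 ^- m :> R.
Proof.
by move=> mn; rewrite lef_pV2 ?posrE ?exprn_gt0// ler_eXn2l ?ltr1n.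
Qed.

Lemma differentiable01P f z : differentiable01 f z <->
  exists l, forall e, 0 < e -> exists2 d, 0 < d &
    forall y, y \in `[0, 1] -> y != z -> `|y - z| < d ->
      `|(f y - f z) / (y - z) - l| <= e.
Proof.
split=> -[l hl]; exists l.
  move=> e e0; move/cvgrPdist_le : hl => /(_ e e0).
  rewrite near_withinE => /nbhs_ballP[d /= d0 hd]; exists d => // y y01 yz yd.
  by rewrite distrC; apply: hd; rewrite /ball /= ?(distrC z).
apply/cvgrPdist_le => e /hl[d d0 hd]; rewrite near_withinE.
apply/nbhs_ballP; exists d => //= y; rewrite /ball /= distrC => yd [y01 yz].
by rewrite distrC; exact: hd.
Qed.

Lemma cauchy_differentiable01 f z : z \in `[0, 1] ->
  (forall e, 0 < e -> exists2 d, 0 < d &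
    forall y y', y \in `[0, 1] -> y != z -> `|y - z| < d ->
      y' \in `[0, 1] -> y' != z -> `|y' - z| < d ->
      `|(f y - f z) / (y - z) - (f y' - f z) / (y' - z)| <= e) ->
  differentiable01 f z.
Proof.
move=> z01 hC; set D := [set y | y \in `[0, 1] /\ y != z].
(* The punctured neighbourhood filter is proper: a step of length at most 1/2 towards the farther
   end of [[0, 1]] stays inside. *)
have DP d : 0 < d -> exists y, D y /\ `|y - z| < d.
  move=> d0; move: z01; rewrite in_itv /= => /andP[z0 z1].
  pose t := Num.min (d / 2) 2^-1.
  have t0 : 0 < t by rewrite lt_min; apply/andP; split; lra.
  have td : t <= d / 2 by rewrite ge_min lexx.
  have th : t <= 2^-1 by rewrite ge_min lexx orbT.
  have [zh|zh] := leP z 2^-1.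
    exists (z + t); split; first (split; first by rewrite in_itv /=; lra).
      by apply/eqP; lra.
    by rewrite addrC addKr gtr0_norm//; lra.
  exists (z - t); split; first (split; first by rewrite in_itv /=; lra).
    by apply/eqP; lra.
  by rewrite addrC addKr normrN gtr0_norm//; lra.
have FF : ProperFilter (within D (nbhs z)).
  apply: within_nbhs_proper => A /nbhs_ballP[d /= d0 hd].
  have [y [Dy yd]] := DP d d0; exists y; split=> //.
  by apply: hd; rewrite /ball /= distrC.
have FP := fmap_proper_filter (fun y => (f y - f z) / (y - z)) FF.
suff /cauchy_cvg/cvg_ex[l hl] : cauchy ((f y - f z) / (y - z) @[y --> within D (nbhs z)]).
  by exists l.
apply: cauchy_exP => e e0.
have [d d0 hd] := hC (e / 2) ltac:(lra).
have [y [[y01 yz] yd]] := DP d d0.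
exists ((f y - f z) / (y - z)).
apply/nbhs_ballP; exists d => //= y'; rewrite /ball /= distrC => y'd [y'01 y'z].
by apply: (le_lt_trans (hd y y' _ _ _ _ _ _)) => //; lra.
Qed.

(** The slope of a chord straddling [z] is a convex combination of the difference quotients at [z]
    of its two ends. *)
Lemma differentiable01_chord f z l :
  (forall e, 0 < e -> exists2 d, 0 < d &
    forall y, y \in `[0, 1] -> y != z -> `|y - z| < d ->
      `|(f y - f z) / (y - z) - l| <= e) ->
  forall e, 0 < e -> exists2 d, 0 < d &
    forall a b, a \in `[0, 1] -> b \in `[0, 1] -> a <= z <= b -> a < b ->
      b - a < d -> `|(f b - f a) / (b - a) - l| <= e.
Proof.
move=> hl e /hl[d d0 hd]; exists d => // a b a01 b01 /andP[az zb] ab bad.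
(* Multiplied out by [y - z], the estimate also covers a chord with one end at [z]. *)
have H y : y \in `[0, 1] -> `|y - z| < d ->
    `|f y - f z - l * (y - z)| <= e * `|y - z|.
  move=> y01 yd; have [->|yz] := eqVneq y z.
    by rewrite !subrr mulr0 normr0 subr0 normr0 mulr0.
  have yz0 : y - z != 0 by rewrite subr_eq0.
  have -> : f y - f z - l * (y - z) = ((f y - f z) / (y - z) - l) * (y - z).
    by field.
  by rewrite normrM ler_wpM2r// hd.
have ba0 : 0 < b - a by lra.
have -> : (f b - f a) / (b - a) - l =
    ((f b - f z - l * (b - z)) - (f a - f z - l * (a - z))) / (b - a).
  by field; rewrite gt_eqF.
rewrite normrM normfV (gtr0_norm ba0) ler_pdivrMr//.
apply: le_trans (ler_normB _ _) _.
have -> : e * (b - a) = e * `|b - z| + e * `|a - z|.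
  by rewrite (ger0_norm (_ : 0 <= b - z)) ?(ler0_norm (_ : a - z <= 0)); first ring; lra.
by apply: lerD; apply: H => //; rewrite ltr_norml; lra.
Qed.

End Real.

(** * Cauchy names *)

Section Names.
Variable R : realType.

Lemma ratr_sgn_div (s a b : nat) :
  ratr ((-1) ^+ s * a%:R / b.+1%:R) = (-1) ^+ s * a%:R / b.+1%:R :> R.
Proof.
by rewrite fmorph_div /= rmorphM /= rmorphXn /= rmorphN /= rmorph1 !ratr_nat.
Qed.

Lemma ratr_exp2V n : ratr (2 ^- n) = 2 ^- n :> R.
Proof. by rewrite fmorphV /= rmorphXn /= ratr_nat. Qed.

Lemma exp2VS n : 2 ^- n = 2 ^- n.+1 + 2 ^- n.+1 :> R.
Proof. by rewrite exprS invfM; lra. Qed.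

(** The steps after [n] add up to at most [2 ^- n]; the partial bounds telescope and pass to the
    limit. *)
Lemma cauchy_name_dist (q : nat -> rat) (x : R) : cauchy_name q x ->
  forall n, `|ratr (q n) - x| <= 2 ^- n.
Proof.
move=> [qq qx] n.
have step m : `|ratr (q m.+1) - ratr (q m) : R| <= 2 ^- m.+1.
  by rewrite -rmorphB -ratr_norm -ratr_exp2V ler_rat; apply: (qq m.+1).
have tail j : `|ratr (q n) - ratr (q (n + j)%N) : R| <= 2 ^- n - 2 ^- (n + j).
  elim: j => [|j IHj]; first by rewrite addn0 !subrr normr0.
  rewrite -(subrKA (ratr (q (n + j)%N))) (le_trans (ler_normD _ _))//.
  have := step (n + j)%N; rewrite distrC addnS.
  by move: IHj; rewrite (exp2VS (n + j)); lra.
have qnx : `|ratr (q n) - ratr (q j)| @[j --> \oo] --> `|ratr (q n) - x|.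
  by apply: cvg_norm; apply: cvgB => //; exact: cvg_cst.
apply: (cvgr_to_le qnx); exists n => // j /= nj.
by have := tail (j - n)%N; rewrite subnKC//; have := exp2V_gt0 R j; lra.
Qed.

(* Truncated subtraction is harmless: the approximated quantity is >= 0. *)
Lemma computable_realseq_nat_approx (y : nat -> R) (C : nat) :
  computable_realseq y -> (forall k, 0 <= y k + C%:R) ->
  exists2 F : nat -> nat -> nat, computable2 F &
    forall k n, `|(F k n)%:R - 2 ^+ n * (y k + C%:R)| <= 2.
Proof.
move=> [q [[s [a [b [cs ca cb qE]]]] qy]] yC.
pose fl k n := ((a k n * 2 ^ n) %/ (b k n).+1)%N.
exists (fun k n => if odd (s k n) then (C * 2 ^ n - fl k n)%N
                   else (C * 2 ^ n + fl k n)%N).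
  by apply/computable2P; rewrite /fl; apply: rec_fun_if; rec_fun_tac.
move=> k n; have := cauchy_name_dist (qy k) n; rewrite qE ratr_sgn_div.
move: (yC k); set w := y k + C%:R => w0.
have -> : y k = w - C%:R by rewrite /w addrK.
set E : R := 2 ^+ n; have E0 : 0 < E by rewrite exprn_gt0.
set v : R := (a k n)%:R / (b k n).+1%:R.
have flE : (fl k n)%:R <= v * E < (fl k n)%:R + 1.
  rewrite /v /E mulrAC ler_pdivlMr ?ltr0Sn// ltr_pdivrMr ?ltr0Sn//.
  rewrite natr1 -natrX -!natrM ler_nat ltr_nat /fl leq_trunc_div /=.
  by rewrite ltn_ceil.
rewrite -mulrA -/v => h.
(* After scaling by [2 ^+ n] the name contributes an error of at most 1, and the floor [fl] another
   one below 1. *)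
have {}h : `|E * ((-1) ^+ s k n * v - (w - C%:R))| <= 1.
  rewrite normrM (gtr0_norm E0) mulrC -ler_pdivlMr// mul1r; exact: h.
have Ew : 0 <= E * w by rewrite mulr_ge0// ltW.
move: h; rewrite -signr_odd; case: (odd (s k n)) => /=; last first.
  by rewrite expr0 mul1r natrD natrM natrX -/E !ler_norml; nra.
rewrite expr1 mulN1r !ler_norml => h.
have [le|lt] := leqP (fl k n) (C * 2 ^ n).
  by rewrite natrB// natrM natrX -/E; nra.
move: lt; rewrite -(ltr_nat R) natrM natrX -/E => lt.
have -> : (C * 2 ^ n - fl k n)%N = 0%N.
  by apply/eqP; rewrite subn_eq0 ltnW// -(ltr_nat R) natrM natrX.
by rewrite sub0r; nra.
Qed.

(** A single sequence through all dyadic points of [[0, 1]], so that one application of the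
    computability of [f] yields all its values there uniformly. The cap on the numerator keeps every
    code inside [[0, 1]]. *)
Lemma computable_dyadics : computable_realseq
  (fun k => dyadic R (minn (nsnd k) (2 ^ nfst k)) (nfst k)).
Proof.
pose a k (n : nat) := minn (nsnd k) (2 ^ nfst k).
pose b k (n : nat) := (2 ^ nfst k).-1.
exists (fun k n => (-1) ^+ 0 * (a k n)%:R / (b k n).+1%:R); split.
  exists (fun _ _ => 0%N), a, b; split=> //; apply/computable2P; rewrite /a /b;
    by rec_fun_tac.
move=> k; split=> [n n0|]; first by rewrite subrr normr0 invr_ge0 exprn_ge0.
rewrite (_ : (fun n => _) = fun=> dyadic R (a k 0%N) (nfst k)); first exact: cvg_cst.
apply/funext => n.
by rewrite ratr_sgn_div /b prednK ?expn_gt0// expr0 mul1r natrX.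
Qed.

Lemma dyadic01 p e : (p <= 2 ^ e)%N -> dyadic R p e \in `[0, 1].
Proof.
move=> pe; rewrite in_itv /= /dyadic divr_ge0 ?exprn_ge0//=.
by rewrite ler_pdivrMr ?exprn_gt0// mul1r -natrX ler_nat.
Qed.

(** Walking from 0 to [x] in steps of length [d] changes [f] by less than 1 per step, and
    [2 ^ (h 0).+1] steps reach 1. Halving [2 ^- h 0] makes the modulus inequality strict. *)
Lemma computable_fun01_bounded (f : R -> R) : computable_fun01 f ->
  exists C : nat, forall x, x \in `[0, 1] -> 0 <= f x + C%:R.
Proof.
move=> [_ [h _ hf]]; pose d : R := 2 ^- (h 0%N).+1.
have d0 : 0 < d by exact: exp2V_gt0.
have step n x : x \in `[0, 1] -> x <= n%:R * d -> `|f x - f 0| <= n%:R.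
  elim: n x => [|n IHn] x.
    rewrite in_itv /= mul0r => /andP[x0 _] x1.
    by have -> : x = 0; [apply/eqP; rewrite eq_le x0 x1|rewrite subrr normr0].
  move=> x01; rewrite -natr1 mulrDl mul1r => xn.
  pose x' := Num.max 0 (x - d).
  move: (x01); rewrite in_itv /= => /andP[x0 x1].
  have x'01 : x' \in `[0, 1].
    by rewrite in_itv /= le_max lexx /= ge_max ler01 /=; lra.
  have x'n : x' <= n%:R * d.
    have nd : 0 <= n%:R * d by rewrite mulr_ge0// ltW.
    by rewrite ge_max nd /=; lra.
  have xx' : `|x - x'| < 2 ^- h 0%N.
    have := exp2VS (h 0%N); rewrite -/d => ->.
    have x'x : x' <= x by rewrite ge_max x0 /=; lra.
    have x'd : x - d <= x' by rewrite le_max lexx orbT.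
    by rewrite ger0_norm; lra.
  have := hf _ _ _ x01 x'01 xx'; have := IHn _ x'01 x'n; rewrite expr0 invr1.
  by rewrite !ler_norml ltr_norml; lra.
exists (2 ^ (h 0%N).+1 + Num.bound `|f 0%R|%R)%N => x x01.
have := step (2 ^ (h 0%N).+1)%N x x01.
rewrite natrX /d mulfV ?expf_neq0 ?pnatr_eq0// natrD natrX.
have := archi_boundP (normr_ge0 (f 0)).
move: x01; rewrite in_itv /= => /andP[x0 x1] hb /(_ x1).
by move: hb; rewrite ltr_norml ler_norml; lra.
Qed.

End Names.

(** * Slopes of dyadic chords *)

Section Slopes.
Variable R : realType.

Definition slope (f : R -> R) (a b : R) : R := (f b - f a) / (b - a).

(* [F e p] is within [2] of [2^e * (f (p / 2^e) + C)]; the summand with the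
   factor [4] absorbs this error in both slopes, so that the test implies that
   the slope of the first chord exceeds that of the second by [2^-k]. *)
Definition chord_test (F : nat -> nat -> nat) (k m e i j i' j' : nat) : bool :=
  ([&& i < j <= 2 ^ e, i' < j' <= 2 ^ e,
      ((j - i) * 2 ^ m < 2 ^ e) && ((j' - i') * 2 ^ m < 2 ^ e),
      maxn i i' <= minn j j' &
      2 ^ k * (F e i * (j' - i') + F e j' * (j - i) +
               4 * ((j - i) + (j' - i'))) + (j - i) * (j' - i') <
      2 ^ k * (F e j * (j' - i') + F e i' * (j - i))])%N.

Section Test.
Variables (f : R -> R) (C : nat) (F : nat -> nat -> nat).
Hypothesis FE : forall e p, (p <= 2 ^ e)%N ->
  `|(F e p)%:R - 2 ^+ e * (f (dyadic R p e) + C%:R)| <= 2.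

Lemma slope_dyadic e i j : (i < j)%N ->
  slope f (dyadic R i e) (dyadic R j e) =
  (2 ^+ e * (f (dyadic R j e) + C%:R) - 2 ^+ e * (f (dyadic R i e) + C%:R)) /
  (j - i)%:R.
Proof.
move=> ij; rewrite /slope natrB 1?ltnW//.
have -> : dyadic R j e - dyadic R i e = (j%:R - i%:R) / 2 ^+ e.
  by rewrite /dyadic mulrBl.
have ij0 : j%:R - i%:R != 0 :> R by rewrite subr_eq0 eqr_nat gtn_eqF.
by field; rewrite ij0 expf_neq0.
Qed.

Lemma slope_approx e i j : (i < j)%N -> (j <= 2 ^ e)%N ->
  `|slope f (dyadic R i e) (dyadic R j e) -
    ((F e j)%:R - (F e i)%:R) / (j - i)%:R| <= 4 / (j - i)%:R.
Proof.
move=> ij je; rewrite slope_dyadic// -mulrBl normrM.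
have ij0 : 0 < (j - i)%:R :> R by rewrite ltr0n subn_gt0.
rewrite normfV (gtr0_norm ij0) ler_pM2r ?invr_gt0//.
have := FE je; have := FE (leq_trans (ltnW ij) je); rewrite !ler_norml; lra.
Qed.

(** The integer test is the real inequality cleared of its denominators; each slope carries the
    error [4 / (j - i)], coming from an error of 2 at each end of the chord. *)
Lemma chord_ineqE k e i j i' j' : (i < j)%N -> (i' < j')%N ->
  (2 ^ k * (F e i * (j' - i') + F e j' * (j - i) +
               4 * ((j - i) + (j' - i'))) + (j - i) * (j' - i') <
      2 ^ k * (F e j * (j' - i') + F e i' * (j - i)))%N =
  (2 ^- k + 4 / (j - i)%:R + 4 / (j' - i')%:R <
    ((F e j)%:R - (F e i)%:R) / (j - i)%:R -
    ((F e j')%:R - (F e i')%:R) / (j' - i')%:R :> R).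
Proof.
move=> ij ij'; rewrite -(ltr_nat R) !(natrD, natrM, natrX).
have : 0 < (j - i)%:R :> R by rewrite ltr0n subn_gt0.
have : 0 < (j' - i')%:R :> R by rewrite ltr0n subn_gt0.
have : 0 < 2 ^+ k :> R by rewrite exprn_gt0.
move: (2 ^+ k) (j - i)%:R (j' - i')%:R => K J J' K0 J'0 J0.
have KJ : 0 < K * (J * J') by rewrite !mulr_gt0.
rewrite -[RHS](ltr_pM2l KJ) -subr_gt0 -[RHS]subr_gt0; congr (0 < _); field.
by rewrite !gt_eqF.
Qed.

Lemma chord_testP k m e i j i' j' : chord_test F k m e i j i' j' ->
  [/\ (i < j <= 2 ^ e)%N, (i' < j' <= 2 ^ e)%N,
    dyadic R j e - dyadic R i e < 2 ^- m,
    dyadic R j' e - dyadic R i' e < 2 ^- m &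
    2 ^- k < slope f (dyadic R i e) (dyadic R j e) -
             slope f (dyadic R i' e) (dyadic R j' e)].
Proof.
have E0 n : 0 < 2 ^+ n :> R by rewrite exprn_gt0.
have len p q : (p < q)%N -> ((q - p) * 2 ^ m < 2 ^ e)%N ->
    dyadic R q e - dyadic R p e < 2 ^- m.
  move=> pq; rewrite -(ltr_nat R) natrM natrB 1?ltnW// !natrX.
  by rewrite /dyadic -mulrBl ltr_pdivrMr// [_^-1 * _]mulrC ltr_pdivlMr.
move=> /and5P[/andP[ij je] /andP[ij' je'] /andP[lij lij'] _]; rewrite chord_ineqE// => h.
rewrite ij ij' je je'; split=> //; try exact: len.
by have := slope_approx ij je; have := slope_approx ij' je';
  rewrite !ler_norml; lra.
Qed.

(** Passing to the grid refined by [2 ^ e0] keeps the chords and their slopes but divides the errors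
    [4 / (j - i)] by [2 ^ e0], so a true gap above [2 ^- k] is eventually detected. *)
Lemma chord_testW k m e i j i' j' :
  (i < j <= 2 ^ e)%N -> (i' < j' <= 2 ^ e)%N ->
  dyadic R j e - dyadic R i e < 2 ^- m ->
  dyadic R j' e - dyadic R i' e < 2 ^- m ->
  (maxn i i' <= minn j j')%N ->
  2 ^- k < slope f (dyadic R i e) (dyadic R j e) -
           slope f (dyadic R i' e) (dyadic R j' e) ->
  exists e0, chord_test F k m (e + e0) (i * 2 ^ e0) (j * 2 ^ e0)
                                       (i' * 2 ^ e0) (j' * 2 ^ e0).
Proof.
move=> /andP[ij je] /andP[ij' je'] lij lij' mm.
set s := slope _ _ _ - _ => ks; have s0 : 0 < s - 2 ^- k by lra.
(* Four errors occur, two in the test and two in the approximation of the slopes; each must be below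
   a quarter of the surplus and has numerator 4, whence 16. *)
have [e0 he0] := exp2V_lt (divr_gt0 s0 (ltr0n R 16)); exists e0.
have E0 n : 0 < 2 ^+ n :> R by rewrite exprn_gt0.
have D0 n : (0 < 2 ^ n)%N by rewrite expn_gt0.
have dE p : dyadic R (p * 2 ^ e0) (e + e0) = dyadic R p e.
  by rewrite /dyadic exprD natrM natrX; field; rewrite !expf_neq0.
have len p q : (p < q)%N -> dyadic R q e - dyadic R p e < 2 ^- m ->
    ((q * 2 ^ e0 - p * 2 ^ e0) * 2 ^ m < 2 ^ (e + e0))%N.
  move=> pq; rewrite /dyadic -mulrBl ltr_pdivrMr// [_^-1 * _]mulrC ltr_pdivlMr//.
  move=> h; rewrite -mulnBl mulnAC expnD ltn_pmul2r// -(ltr_nat R).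
  by rewrite natrM natrB 1?ltnW// !natrX.
have ijx : (i * 2 ^ e0 < j * 2 ^ e0)%N by rewrite ltn_pmul2r.
have ijx' : (i' * 2 ^ e0 < j' * 2 ^ e0)%N by rewrite ltn_pmul2r.
have jex : (j * 2 ^ e0 <= 2 ^ (e + e0))%N by rewrite expnD leq_pmul2r.
have jex' : (j' * 2 ^ e0 <= 2 ^ (e + e0))%N by rewrite expnD leq_pmul2r.
rewrite /chord_test ijx ijx' jex jex' !len//= -maxnMl -minnMl leq_pmul2r// mm /=.
rewrite chord_ineqE//.
have := slope_approx ijx jex; have := slope_approx ijx' jex'.
have small p q : (p < q)%N -> 4 / (q * 2 ^ e0 - p * 2 ^ e0)%:R < (s - 2 ^- k) / 4 :> R.
  move=> pq; rewrite -mulnBl natrM natrX invfM.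
  have : (q - p)%:R^-1 <= 1 :> R by rewrite invf_le1 ?ler1n ?ltr0n subn_gt0.
  have : 0 < (q - p)%:R^-1 :> R by rewrite invr_gt0 ltr0n subn_gt0.
  have := exp2V_gt0 R e0; move: he0; nra.
have := small _ _ ij; have := small _ _ ij'.
by rewrite !dE !ler_norml /s; lra.
Qed.

End Test.
End Slopes.

(** * Straddling chords as a [Pi02] condition on the point *)

Section ChordSets.
Variable R : realType.

Lemma computable_fun01_dyadic_approx (f : R -> R) : computable_fun01 f ->
  exists C : nat, exists2 F : nat -> nat -> nat, computable2 F &
  forall e p, (p <= 2 ^ e)%N ->
    `|(F e p)%:R - 2 ^+ e * (f (dyadic R p e) + C%:R)| <= 2.
Proof.
move=> cf; have [C fC] := computable_fun01_bounded cf; exists C.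
have d01 k : dyadic R (minn (nsnd k) (2 ^ nfst k)) (nfst k) \in `[0, 1].
  by apply: dyadic01; rewrite geq_minr.
have := cf.1 _ d01 (@computable_dyadics R).
move=> /computable_realseq_nat_approx/(_ (fun k => fC _ (d01 k)))[F cF FE].
exists (fun e p => F (npair e p) e).
  by apply/computable2P; rec_fun_tac.
move=> e p pe; have := FE (npair e p) e.
by rewrite npairK1 npairK2 (minn_idPl pe).
Qed.

Definition chord_set (F : nat -> nat -> nat) (k m : nat) : set R :=
  [set x | exists e i j i' j', chord_test F k m e i j i' j' /\
    dyadic R (maxn i i') e < x < dyadic R (minn j j') e].

(** All quintuples are enumerated by codes [K]; the factor [T m K] turns the interval of a failed
    test into the empty []0, 0[]. *)
Lemma chord_set_Sigma01 F k : computable2 F ->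
  uniformly_Sigma01 (chord_set F k).
Proof.
move=> cF.
pose e K := nfst K; pose i K := nfst (nsnd K).
pose j K := nfst (nsnd (nsnd K)); pose i' K := nfst (nsnd (nsnd (nsnd K))).
pose j' K := nsnd (nsnd (nsnd (nsnd K))).
pose T m K : nat := chord_test F k m (e K) (i K) (j K) (i' K) (j' K).
have cT : computable2 T.
  apply/computable2P; rewrite /T /chord_test /e /i /j /i' /j'.
  rec_fun_tac.
exists (fun _ _ => 0%N), (fun m K => T m K * maxn (i K) (i' K))%N, (fun _ K => e K),
  (fun m K => T m K * minn (j K) (j' K))%N, (fun _ K => e K).
split=> [|m K|m].
- by split; apply/computable2P; rewrite /e /i /j /i' /j'; rec_fun_tac.
- have E0 : 0 < 2 ^+ e K :> R by rewrite exprn_gt0.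
  rewrite /dyadic divr_ge0 ?(ltW E0)// ler_pM2r ?invr_gt0//.
  rewrite ler_pdivrMr// mul1r -natrX !ler_nat /T.
  case: (boolP (chord_test _ _ _ _ _ _ _ _)) => [|_]; last by rewrite !mul0n.
  move=> /and5P[/andP[_ je] _ _ mm _]; rewrite !mul1n mm; split=> //.
  by rewrite geq_min je.
- apply/seteqP; split=> [x [e0 [i0 [j0 [i0' [j0' [tx xI]]]]]]|x [K _]] /=.
    exists (npair e0 (npair i0 (npair j0 (npair i0' j0')))) => //=.
    rewrite in_itv /= /T /e /i /j /i' /j' !(npairK1, npairK2) tx !mul1n.
    exact: xI.
  rewrite in_itv /= /T; case: (boolP (chord_test _ _ _ _ _ _ _ _)) => [tK|_].
    rewrite !mul1n => xI.
    by exists (e K), (i K), (j K), (i' K), (j' K).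
  by rewrite !mul0n => /andP[/lt_trans/[apply]]; rewrite ltxx.
Qed.

Lemma le_dyadic p q e : (dyadic R p e <= dyadic R q e) = (p <= q)%N.
Proof. by rewrite /dyadic ler_pM2r ?ler_nat ?invr_gt0 ?exprn_gt0. Qed.

Lemma lt_dyadic p q e : (dyadic R p e < dyadic R q e) = (p < q)%N.
Proof. by rewrite /dyadic ltr_pM2r ?ltr_nat ?invr_gt0 ?exprn_gt0. Qed.

Section Chords.
Variables (f : R -> R) (C : nat) (F : nat -> nat -> nat).
Hypothesis FE : forall e p, (p <= 2 ^ e)%N ->
  `|(F e p)%:R - 2 ^+ e * (f (dyadic R p e) + C%:R)| <= 2.

Lemma chord_set01 k m x : chord_set F k m x -> x \in `[0, 1].
Proof.
move=> [e [i [j [i' [j' [/and5P[/andP[_ je] _ _ _ _] /andP[ax xb]]]]]]].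
have : dyadic R (minn j j') e \in `[0, 1] by apply: dyadic01; rewrite geq_min je.
rewrite !in_itv /= => /andP[_ b1]; rewrite (le_trans (ltW xb) b1) andbT.
by apply: le_trans (ltW ax); rewrite divr_ge0 ?exprn_ge0.
Qed.

(** With a derivative [l] at [x], short chords straddling [x] would have slopes within half of
    [2 ^- k] of [l], hence within [2 ^- k] of each other. *)
Lemma chord_set_not_differentiable k x :
  (forall m, chord_set F k m x) -> ~ differentiable01 f x.
Proof.
move=> xS /differentiable01P[l /differentiable01_chord hl].
have K0 := exp2V_gt0 R k; set K : R := 2 ^- k in K0.
have [d d0 hd] := hl (K / 2) ltac:(lra).
have [m md] := exp2V_lt d0.
have [e [i [j [i' [j' [tx /andP[ax xb]]]]]]] := xS m.
have [/andP[ij je] /andP[ij' je'] lij lij' sl] := chord_testP FE tx.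
have ch p q : (p < q)%N -> (q <= 2 ^ e)%N -> dyadic R p e < x ->
    x < dyadic R q e -> dyadic R q e - dyadic R p e < 2 ^- m ->
    `|slope f (dyadic R p e) (dyadic R q e) - l| <= K / 2.
  move=> pq qe px xq lpq; apply: hd.
  - by apply: dyadic01; rewrite ltnW// (leq_trans pq).
  - exact: dyadic01.
  - by rewrite !ltW.
  - by rewrite lt_dyadic.
  - exact: lt_trans lpq md.
have H := ch _ _ ij je (le_lt_trans _ ax) (lt_le_trans xb _) lij.
have H' := ch _ _ ij' je' (le_lt_trans _ ax) (lt_le_trans xb _) lij'.
move: H H'; rewrite !le_dyadic leq_maxl leq_maxr geq_minl geq_minr.
move=> /(_ isT isT) + /(_ isT isT).
by move: sl; rewrite -/K !ler_norml; lra.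
Qed.

End Chords.

(** * Dyadic approximation of chords at an interior point *)

Lemma floor_dyadic (u z : R) n : 0 <= u <= 1 -> u <= z -> 0 < z ->
  exists p, [/\ (p <= 2 ^ n)%N, dyadic R p n < z, dyadic R p n <= u &
                u - dyadic R p n <= 2 * 2 ^- n].
Proof.
move=> /andP[u0 u1] uz z0; set E : R := 2 ^+ n.
have E0 : 0 < E by rewrite exprn_gt0.
have := truncn_itv (mulr_ge0 u0 (ltW E0)); set t := Num.truncn _ => /andP[tl tu].
have tE : u - (t%:R / E) <= E^-1.
  have : u <= t.+1%:R / E by rewrite ler_pdivlMr// ltW.
  by rewrite -natr1 mulrDl mul1r; lra.
have tn : (t <= 2 ^ n)%N.
  rewrite -(ler_nat R) natrX -/E (le_trans tl)//; nra.
have tu' : t%:R / E <= u by rewrite ler_pdivrMr.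
have EV : 0 < E^-1 by rewrite invr_gt0.
(* The floor may equal [z], so the grid point just before it is taken; if the floor is 0, it is
   already below [z]. This doubles the error. *)
case: t tE tn tu' {tl tu} => [|t] tE tn tu'.
  by exists 0%N; rewrite /dyadic mul0r subr0 -/E; move: tE; rewrite mul0r subr0;
     split=> //; lra.
exists t; rewrite /dyadic -/E; move: tE tu'; rewrite -natr1 mulrDl mul1r.
by move=> tE tu'; split; [exact: ltnW|lra|lra|lra].
Qed.

Lemma ceil_dyadic (v z : R) n : 0 <= v <= 1 -> z <= v -> z < 1 ->
  exists p, [/\ (p <= 2 ^ n)%N, z < dyadic R p n, v <= dyadic R p n &
                dyadic R p n - v <= 2 * 2 ^- n].
Proof.
move=> v01 zv z1.
have [||| p [pn pz pv vp]] := @floor_dyadic (1 - v) (1 - z) n; try lra.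
exists (2 ^ n - p)%N.
have -> : dyadic R (2 ^ n - p) n = 1 - dyadic R p n.
  by rewrite /dyadic natrB// mulrBl natrX mulfV// expf_neq0.
by split; [exact: leq_subr|lra|lra|lra].
Qed.

Lemma computable_fun01_continuous (f : R -> R) (x : R) (u : nat -> R) :
  computable_fun01 f -> x \in `[0, 1] -> (forall n, u n \in `[0, 1]) ->
  u n @[n --> \oo] --> x -> f (u n) @[n --> \oo] --> f x.
Proof.
move=> [_ [h _ hf]] x01 u01 ux; apply/cvgrPdist_lt => e e0.
have [n ne] := exp2V_lt e0.
move/cvgrPdist_lt : ux => /(_ _ (exp2V_gt0 R (h n))).
by apply: filterS => m xu; apply: lt_trans ne; exact: hf.
Qed.

Lemma slope_sym (f : R -> R) a b : slope f a b = slope f b a.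
Proof. by rewrite /slope -(opprB (f a)) -(opprB a) invrN mulrNN. Qed.

(** The chord from [z] to [y] has [z] as an end point, whereas the chord sets need [z] strictly
    inside; it is approached by dyadic chords rounded outwards, whose slopes converge by
    continuity. *)
Lemma dyadic_chord_cvg (f : R -> R) (y z : R) : computable_fun01 f ->
  0 < z < 1 -> y \in `[0, 1] -> y != z ->
  exists i j : nat -> nat,
  [/\ forall n, [/\ (j n <= 2 ^ n)%N, dyadic R (i n) n < z &
                    z < dyadic R (j n) n],
      dyadic R (j n) n - dyadic R (i n) n @[n --> \oo] --> `|y - z| &
      slope f (dyadic R (i n) n) (dyadic R (j n) n) @[n --> \oo] -->
        slope f z y].
Proof.
move=> cf /andP[z0 z1]; rewrite in_itv /= => /andP[y0 y1] yz.
pose u := Num.min y z; pose v := Num.max y z.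
have [u01 v01 uz zv] : [/\ 0 <= u <= 1, 0 <= v <= 1, u <= z & z <= v].
  by rewrite /u /v; case: (ltP y z) => ?; split; lra.
have uv : v - u = `|y - z|.
  by rewrite /u /v; case: (ltP y z) => ?; [rewrite ltr0_norm|rewrite ger0_norm]; lra.
have suv : slope f u v = slope f z y.
  by rewrite /u /v; case: (ltP y z) => // _; exact: slope_sym.
have uv0 : v - u != 0 by rewrite uv normr_eq0 subr_eq0.
have /choice[i hi] n := @floor_dyadic u z n u01 uz z0.
have /choice[j hj] n := @ceil_dyadic v z n v01 zv z1.
have small : 2 * 2 ^- n @[n --> \oo] --> (0 : R).
  have -> : (fun n => 2 * 2 ^- n) = geometric 2 2^-1 :> (nat -> R).
    by apply/funext => n; rewrite /= exprVn.
  by apply: cvg_geometric; rewrite ger0_norm ?invr_ge0//; lra.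
have iu : dyadic R (i n) n @[n --> \oo] --> u.
  rewrite -[u]subr0; apply: (@squeeze_cvgr _ _ _ _ (fun n => u - 2 * 2 ^- n) (fun=> u)).
  - by near=> n; have [_ _] := hi n; lra.
  - by apply: cvgB small; exact: cvg_cst.
  - by rewrite subr0; exact: cvg_cst.
have jv : dyadic R (j n) n @[n --> \oo] --> v.
  rewrite -[v]addr0; apply: (@squeeze_cvgr _ _ _ _ (fun=> v) (fun n => v + 2 * 2 ^- n)).
  - by near=> n; have [_ _] := hj n; lra.
  - by rewrite addr0; exact: cvg_cst.
  - by apply: cvgD small; exact: cvg_cst.
have i01 n : dyadic R (i n) n \in `[0, 1] by apply: dyadic01; have [] := hi n.
have j01 n : dyadic R (j n) n \in `[0, 1] by apply: dyadic01; have [] := hj n.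
have ji : dyadic R (j n) n - dyadic R (i n) n @[n --> \oo] --> v - u.
  exact: cvgB.
exists i, j; split.
- by move=> n; have [_ ? _ _] := hi n; have [? ? _ _] := hj n.
- by rewrite -uv.
- rewrite -suv; apply: cvgM; last exact: cvgV.
  by apply: cvgB; apply: computable_fun01_continuous.
Unshelve. all: by end_near.
Qed.

(** Two difference quotients near [z] are limits of slopes of short dyadic chords around [z]. As [z]
    avoids a chord set for [k], these slopes differ by at most [2 ^- k], so the quotients are
    Cauchy. *)
Lemma not_chord_set_differentiable (f : R -> R) C F z :
  computable_fun01 f -> 0 < z < 1 ->
  (forall e p, (p <= 2 ^ e)%N ->
    `|(F e p)%:R - 2 ^+ e * (f (dyadic R p e) + C%:R)| <= 2) ->
  (forall k, exists m, ~ chord_set F k m z) -> differentiable01 f z.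
Proof.
move=> cf z01 FE zS.
have zin : z \in `[0, 1] by rewrite in_itv /=; lra.
apply: cauchy_differentiable01 => // e e0.
have [k ke] := exp2V_lt e0; have [m zm] := zS k.
exists (2 ^- m) => [|y y' y01 yz ym y'01 y'z y'm]; first exact: exp2V_gt0.
have [i [j [ijz lij sij]]] := dyadic_chord_cvg cf z01 y01 yz.
have [i' [j' [ijz' lij' sij']]] := dyadic_chord_cvg cf z01 y'01 y'z.
apply: le_trans (ltW ke).
have /cvgr_to_le : `|slope f (dyadic R (i n) n) (dyadic R (j n) n) -
    slope f (dyadic R (i' n) n) (dyadic R (j' n) n)| @[n --> \oo] -->
    `|slope f z y - slope f z y'| by apply: cvg_norm; exact: cvgB.
apply.
have main n p q p' q' : (q <= 2 ^ n)%N -> (q' <= 2 ^ n)%N ->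
    dyadic R p n < z -> z < dyadic R q n ->
    dyadic R p' n < z -> z < dyadic R q' n ->
    dyadic R q n - dyadic R p n < 2 ^- m ->
    dyadic R q' n - dyadic R p' n < 2 ^- m ->
    slope f (dyadic R p n) (dyadic R q n) -
    slope f (dyadic R p' n) (dyadic R q' n) <= 2 ^- k.
  move=> qn q'n pz zq pz' zq' l l'; rewrite leNgt; apply/negP => sl; apply: zm.
  have mm : dyadic R (maxn p p') n < z < dyadic R (minn q q') n.
    by apply/andP; split; [rewrite /maxn|rewrite /minn]; case: ifP.
  have [|||e0' t] := chord_testW FE _ _ l l' _ sl.
  - by rewrite -(lt_dyadic p q n) (lt_trans pz zq).
  - by rewrite -(lt_dyadic p' q' n) (lt_trans pz' zq').
  - by rewrite -(le_dyadic _ _ n); case/andP: mm => /lt_trans h /h/ltW.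
  have dE p0 : dyadic R (p0 * 2 ^ e0') (n + e0') = dyadic R p0 n.
    by rewrite /dyadic exprD natrM natrX; field; rewrite !expf_neq0.
  by do 5 eexists; split; [exact: t|rewrite -maxnMl -minnMl !dE].
near=> n.
have [jn iz zj] := ijz n; have [jn' iz' zj'] := ijz' n.
have l : dyadic R (j n) n - dyadic R (i n) n < 2 ^- m.
  by near: n; apply: cvgr_lt lij _ _.
have l' : dyadic R (j' n) n - dyadic R (i' n) n < 2 ^- m.
  by near: n; apply: cvgr_lt lij' _ _.
have := main n _ _ _ _ jn jn' iz zj iz' zj' l l'.
have := main n _ _ _ _ jn' jn iz' zj' iz zj l' l.
by rewrite ler_norml; lra.
Unshelve. all: by end_near.
Qed.

(** * From weak 2-randomness to differentiability *)

Lemma measurable_Pi02 (S : set R) : Pi02 S -> measurable S.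
Proof.
move=> [G [t [p [d [q [e [_ _ GE]]]]]] ->].
apply: bigcap_measurable => // m _; rewrite GE; apply: bigcup_measurable => k _.
by rewrite /open_interval01; case: (t m k) => [|[|[|?]]]; exact: measurable_itv.
Qed.

(** Both end points are null [Pi02] singletons: intersections of the [[0, 2^-m)] and of the
    [(1 - 2^-m, 1]] respectively. *)
Lemma weakly2random_interior (z : R) : weakly2random z -> 0 < z < 1.
Proof.
move=> [z01 zr]; move: (z01); rewrite in_itv /= => /andP[z0 z1].
have E n : 2 ^+ n != 0 :> R by rewrite expf_neq0.
rewrite !lt_neqAle z0 z1 !andbT; apply/andP; split.
  apply/eqP => z00; apply: (zr [set 0]) => //=; last by rewrite lebesgue_measure_set1.
  exists (fun m => `[0, 2 ^- m[%classic).
    exists (fun _ _ => 1%N), (fun _ _ => 0%N), (fun _ _ => 0%N), (fun _ _ => 1%N),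
      (fun m _ => m); split=> [|m k|m].
    - by split; apply/computable2P; rec_fun_tac.
    - have := @exp2V_le R 0 m isT; have := exp2V_gt0 R m.
      by rewrite /dyadic mul0r mul1r expr0 invr1; split; lra.
    - by rewrite bigcup_const//= /dyadic mul1r.
  apply/seteqP; split=> [x /= -> m _ /=|x xm /=].
    by rewrite in_itv /= lexx exp2V_gt0.
  have := xm 0%N I; rewrite /= in_itv /= => /andP[x0 _]; apply/eqP.
  rewrite eq_le x0 andbT leNgt; apply/negP => /exp2V_lt[n nx].
  by have := xm n I; rewrite /= in_itv /= => /andP[_ /(lt_trans nx)]; rewrite ltxx.
apply/eqP => z11; apply: (zr [set 1]) => //=; last by rewrite lebesgue_measure_set1.
exists (fun m => `]1 - 2 ^- m, 1]%classic).
  exists (fun _ _ => 2%N), (fun m _ => (2 ^ m - 1)%N), (fun m _ => m),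
    (fun _ _ => 1%N), (fun _ _ => 0%N).
  have dE m : dyadic R (2 ^ m - 1) m = 1 - 2 ^- m.
    by rewrite /dyadic natrB ?expn_gt0// mulrBl natrX mulfV// mul1r.
  split=> [|m k|m].
  - by split; apply/computable2P; rec_fun_tac.
  - have := @exp2V_le R 0 m isT; have := exp2V_gt0 R m.
    by rewrite dE /dyadic expr0 divr1 invr1; split; lra.
  - by rewrite bigcup_const//= dE.
apply/seteqP; split=> [x /= -> m _ /=|x xm /=].
  by rewrite in_itv /= lexx andbT; have := exp2V_gt0 R m; lra.
have := xm 0%N I; rewrite /= in_itv /= => /andP[_ x1]; apply/eqP.
rewrite eq_le x1 /= leNgt; apply/negP => xl1.
have [|n nx] := @exp2V_lt R (1 - x); first lra.
by have := xm n I; rewrite /= in_itv /= => /andP[]; lra.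
Qed.

Lemma weakly2random_differentiable (z : R) (f : R -> R) :
  weakly2random z -> computable_fun01 f ->
  {ae lebesgue_measure, forall x : R, x \in `[0, 1] -> differentiable01 f x} ->
  differentiable01 f z.
Proof.
move=> zr cf aef; have z01 := weakly2random_interior zr.
have [C [F cF FE]] := computable_fun01_dyadic_approx cf.
apply: (not_chord_set_differentiable cf z01 FE) => k.
apply/existsNP => zS; apply: (zr.2 (\bigcap_m chord_set F k m)); last by move=> m _.
  by exists (chord_set F k) => //; exact: chord_set_Sigma01.
apply: measure_negligible.
  by apply: measurable_Pi02; exists (chord_set F k) => //; exact: chord_set_Sigma01.
apply: negligibleS aef => x xS /= dx.
apply: (chord_set_not_differentiable FE (fun m => xS m I)).
by apply: dx; apply: chord_set01 (xS 0%N I).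
Qed.

End ChordSets.

(** * Levels and bets *)

Section Bets.
Local Open Scope nat_scope.
Variables t p d q e : nat -> nat -> nat.
Hypotheses (ct : computable2 t) (cp : computable2 p) (cd : computable2 d)
  (cq : computable2 q) (ce : computable2 e).

(* [[c / 4^n - 2^-n, (c + 1) / 4^n + 2^-n]], cut down to [[0, 1]], is contained in
   the interval of shape [t] with end points [p / 2^d] and [q / 2^e]. *)
Definition cell_test (t p d q e n c : nat) : bool :=
  (2 < t) ||
  (((0 < t) && (t <= 1)) || (p * 4 ^ n + 2 ^ d * 2 ^ n < c * 2 ^ d)) &&
  ((1 < t) || ((c.+1 + 2 ^ n) * 2 ^ e < q * 4 ^ n)).

(** Only the first [n] intervals are inspected at depth [n], which makes the test decidable, while
    each interval is inspected at all large depths. *)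
Definition hit (m n c : nat) : bool :=
  [exists k : 'I_n, cell_test (t m k) (p m k) (d m k) (q m k) (e m k) n c].

(* [c %/ 4 ^ (n - i)] is the index of the ancestor at depth [i] of the 4-adic
   interval number [c] at depth [n]. *)
Definition level_rec (n c i : nat) : nat :=
  nat_rect (fun=> nat) 0 (fun i r => r + hit r i (c %/ 4 ^ (n - i))) i.

Definition level (n c : nat) : nat := level_rec n c n.

Definition bet (n c : nat) : bool := hit (level n c) n c.

Lemma levelS n c : level n.+1 c = level n (c %/ 4) + bet n (c %/ 4).
Proof.
(* The cells [c] and [c %/ 4] have the same ancestors up to depth [n]. *)
have rec i : i <= n -> level_rec n.+1 c i = level_rec n (c %/ 4) i.
  elim: i => [//|i IHi] ltin; rewrite /= IHi 1?ltnW//.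
  by rewrite subSn 1?ltnW// expnS divnMA.
by rewrite /level /= rec// subSnn expn1 /bet /level.
Qed.

Lemma rec_fun_hit k m n c : rec_fun k m -> rec_fun k n -> rec_fun k c ->
  rec_fun k (fun v => hit (m v) (n v) (c v)).
Proof.
move=> cm cn cc; apply: (rec_fun_exists (h := fun i v => cell_test
  (t (m v) i) (p (m v) i) (d (m v) i) (q (m v) i) (e (m v) i) (n v) (c v))) => //.
by rewrite /cell_test; rec_fun_tac.
Qed.

Lemma rec_fun_bet k n c : rec_fun k n -> rec_fun k c ->
  rec_fun k (fun v => bet (n v) (c v)).
Proof.
move=> cn cc; apply: rec_fun_hit => //.
apply: (rec_fun_rec (h := fun i r v => r + hit r i (c v %/ 4 ^ (n v - i)))) => //.
  exact: rec_fun_cst.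
apply: rec_fun_add; first exact: rec_fun_nth.
apply: rec_fun_hit; try exact: rec_fun_nth.
(* The divisor is rewritten as a successor, the form in which division was shown recursive. *)
apply: (@eq_rec_fun _ (fun w => c (drop 2 w) %/
   (4 ^ (n (drop 2 w) - nth 0 w 0)).-1.+1)).
  by move=> w; rewrite prednK// expn_gt0.
by rec_fun_tac.
Qed.

(** A descending branch of 4-adic cells. It is kept apart from the cells of a point because the
    point 1 has to be followed through the cells to its left. *)
Definition path4 (c : nat -> nat) : Prop := forall n, c n.+1 %/ 4 = c n.

Lemma level_path c n : path4 c ->
  level n.+1 (c n.+1) = level n (c n) + bet n (c n).
Proof. by move=> cc; rewrite levelS cc. Qed.

(** The level rises by at most one per depth, so it passes [m] only through a cell hit for [m]. *)
Lemma level_path_hit c m n : path4 c -> m < level n (c n) ->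
  exists n', hit m n' (c n').
Proof.
move=> cc; elim: n => [//|n IHn]; rewrite level_path//.
have [/IHn //|le] := ltnP m (level n (c n)).
case b : (bet n (c n)) => /= mlt; last by lia.
have mE : m = level n (c n) by lia.
by exists n; rewrite mE.
Qed.

Lemma bets_level_unbounded c : path4 c ->
  (forall N, exists2 n, N <= n & bet n (c n)) ->
  forall m, exists n, m <= level n (c n).
Proof.
move=> cc hb; elim=> [|m [N mN]]; first by exists 0.
have mono i : m <= level (N + i) (c (N + i)).
  by elim: i => [|i IHi]; rewrite ?addn0// addnS level_path//; lia.
have [n Nn bn] := hb N; exists n.+1; rewrite level_path// bn addn1 ltnS.
by have := mono (n - N); rewrite subnKC.
Qed.

Lemma level_path_const c N n : path4 c -> N <= n ->
  (forall i, N <= i < n -> ~~ bet i (c i)) -> level n (c n) = level N (c N).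
Proof.
move=> cc; elim: n => [|n IHn]; first by rewrite leqn0 => /eqP->.
rewrite leq_eqVlt => /orP[/eqP-> //|]; rewrite ltnS => Nn nb.
rewrite level_path// (negbTE (nb n _)) ?Nn ?ltnSn// addn0 IHn// => i /andP[Ni li].
by apply: nb; rewrite Ni ltnW.
Qed.

(* [4^M] times the value at [j / 4^M] of the sum of tents. *)
Definition wave_nat (M j : nat) : nat :=
  \sum_(n < M) bet n (j %/ 4 ^ (M - n)) *
    minn (j - j %/ 4 ^ (M - n) * 4 ^ (M - n))
         ((j %/ 4 ^ (M - n)).+1 * 4 ^ (M - n) - j).

Lemma rec_fun_wave_nat k M j : rec_fun k M -> rec_fun k j ->
  rec_fun k (fun v => wave_nat (M v) (j v)).
Proof.
move=> cM cj; apply: (rec_fun_sum (h := fun n v =>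
  bet n (j v %/ 4 ^ (M v - n)) *
  minn (j v - j v %/ 4 ^ (M v - n) * 4 ^ (M v - n))
       ((j v %/ 4 ^ (M v - n)).+1 * 4 ^ (M v - n) - j v))) => //.
have cdiv : rec_fun k.+1 (fun w => j (drop 1 w) %/ 4 ^ (M (drop 1 w) - nth 0 w 0)).
  apply: (@eq_rec_fun _ (fun w => j (drop 1 w) %/
     (4 ^ (M (drop 1 w) - nth 0 w 0)).-1.+1)).
    by move=> w; rewrite prednK// expn_gt0.
  by rec_fun_tac.
apply: rec_fun_mul; first by apply: rec_fun_bet => //; exact: rec_fun_nth.
by rec_fun_tac.
Qed.

End Bets.

(** * Sums of tents *)

Section Wave.
Variables (R : realType) (b : nat -> nat -> bool).
Implicit Types (x y : R) (n c N M : nat).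

Definition grid n c : R := c%:R / 4 ^+ n.
Definition cell n x : nat := Num.truncn (4 ^+ n * x).
(** Closed, unlike the half-open cells selected by [cell]: affine formulas are to hold at both ends
    of a chord. *)
Definition in_cell n c x : bool := grid n c <= x <= grid n c.+1.

Lemma exp4_gt0 n : 0 < 4 ^+ n :> R. Proof. by rewrite exprn_gt0. Qed.

Lemma exp4V_gt0 n : 0 < 4 ^- n :> R. Proof. by rewrite invr_gt0 exp4_gt0. Qed.

Lemma exp4V_exp2V n : 4 ^- n = 2 ^- n * 2 ^- n :> R.
Proof. by rewrite -invfM -exprMn_comm//; congr (_ ^+ _)^-1; ring. Qed.

Lemma exp4VS n : 4 ^- n = 4 * 4 ^- n.+1 :> R.
Proof. by rewrite exprS invfM mulrA mulfV ?mul1r. Qed.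

Lemma gridS n c : grid n c.+1 = grid n c + 4 ^- n.
Proof. by rewrite /grid -natr1 mulrDl mul1r. Qed.

Lemma grid_refine n i c : grid (n + i) (c * 4 ^ i) = grid n c.
Proof.
by rewrite /grid exprD natrM natrX; field; rewrite !expf_neq0.
Qed.

Lemma le_grid n : {mono grid n : c c' / (c <= c')%N >-> c <= c'}.
Proof. by move=> c c'; rewrite /grid ler_pM2r ?invr_gt0 ?exprn_gt0// ler_nat. Qed.

Lemma lt_grid n : {mono grid n : c c' / (c < c')%N >-> c < c'}.
Proof. by move=> c c'; rewrite /grid ltr_pM2r ?invr_gt0 ?exprn_gt0// ltr_nat. Qed.

Lemma cell_itv n x : 0 <= x -> grid n (cell n x) <= x < grid n (cell n x).+1.
Proof.
move=> x0; have := truncn_itv (mulr_ge0 (ltW (exp4_gt0 n)) x0).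
rewrite -/(cell n x) /grid ler_pdivrMr ?exprn_gt0// ltr_pdivlMr ?exprn_gt0//.
by rewrite mulrC.
Qed.

Lemma cell_unique n c x : grid n c <= x < grid n c.+1 -> cell n x = c.
Proof.
rewrite /grid ler_pdivrMr ?exprn_gt0// ltr_pdivlMr ?exprn_gt0// mulrC => h.
by apply/eqP; rewrite truncn_eq//; apply: le_trans (ler0n _ c) _; case/andP: h.
Qed.

Lemma in_cell_parent n c x : in_cell n.+1 c x -> in_cell n (c %/ 4) x.
Proof.
move=> /andP[cx xc]; apply/andP; split.
  by apply: le_trans cx; rewrite -(grid_refine n 1) addn1 le_grid leq_trunc_div.
apply: (le_trans xc); rewrite -(grid_refine n 1) addn1 le_grid expn1.
exact: ltn_ceil.
Qed.

Lemma cell_path x : 0 <= x -> path4 (cell ^~ x).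
Proof.
move=> x0 n; apply/esym/cell_unique.
have /andP[cx xc] := cell_itv n.+1 x0.
have /andP[-> _] : in_cell n (cell n.+1 x %/ 4) x.
  by apply: in_cell_parent; rewrite /in_cell cx ltW.
apply: (lt_le_trans xc); rewrite -(grid_refine n 1) addn1 le_grid expn1.
exact: ltn_ceil.
Qed.

Definition tooth n x : R :=
  (b n (cell n x))%:R *
  Num.min (x - grid n (cell n x)) (grid n (cell n x).+1 - x).

(** At the right end [cell] already selects the next cell, but both tents vanish there. *)
Lemma tooth_cell n c x : in_cell n c x ->
  tooth n x = (b n c)%:R * Num.min (x - grid n c) (grid n c.+1 - x).
Proof.
move=> /andP[cx]; rewrite le_eqVlt => /predU1P[->|xc]; last first.
  by rewrite /tooth (@cell_unique n c) ?cx.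
rewrite /tooth (@cell_unique n c.+1); last by rewrite lexx lt_grid ltnSn.
have ge0 i : 0 <= grid n i.+1 - grid n i by rewrite subr_ge0 le_grid.
by rewrite !subrr (min_l (ge0 _)) (min_r (ge0 _)) !mulr0.
Qed.

Lemma min_cell n c x : in_cell n c x ->
  0 <= Num.min (x - grid n c) (grid n c.+1 - x) <= 4 ^- n / 2.
Proof.
by rewrite /in_cell gridS; case: (leP (x - grid n c) (_ - x)) => ? ?; lra.
Qed.

Lemma cell_in n x : 0 <= x -> in_cell n (cell n x) x.
Proof. by move=> /(cell_itv n)/andP[cx /ltW xc]; rewrite /in_cell cx. Qed.

Lemma tooth_bound n x : 0 <= x -> 0 <= tooth n x <= 4 ^- n / 2.
Proof.
move=> x0; have := min_cell (cell_in n x0); have := exp4V_gt0 n.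
by rewrite /tooth; case: (b _ _) => /=; lra.
Qed.

(** Across different cells, both heights are bounded by the distance to a cell boundary lying
    between the points. *)
Lemma tooth_lipschitz n x y : 0 <= x <= y -> `|tooth n x - tooth n y| <= y - x.
Proof.
move=> /andP[x0 xy]; have y0 := le_trans x0 xy.
have ix := cell_in n x0; have iy := cell_in n y0.
have [cxy|cxy|cxy] := ltngtP (cell n x) (cell n y).
- have := min_cell ix; have := min_cell iy.
  have : grid n (cell n x).+1 <= grid n (cell n y) by rewrite le_grid.
  move: ix iy; rewrite /in_cell /tooth ler_norml.
  case: (leP (x - _) (_ - x)) => ?; case: (leP (y - _) (_ - y)) => ?;
  by case: (b _ _); case: (b _ _) => /=; lra.
- have : grid n (cell n y).+1 <= grid n (cell n x) by rewrite le_grid.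
  have /andP[_ h] := cell_itv n y0.
  by move: ix; rewrite /in_cell; lra.
- move: ix iy; rewrite /in_cell /tooth cxy ler_norml.
  case: (leP (x - _) (_ - x)) => ?; case: (leP (y - _) (_ - y)) => ?;
  by case: (b _ _) => /=; lra.
Qed.

(** The apex is the midpoint of the parent, an end point of two of its four children, so a tent is
    affine on every child. *)
Lemma tooth_child n c : exists s k : R,
  [/\ `|s| = (b n (c %/ 4))%:R &
      forall x, in_cell n.+1 c x -> tooth n x = s * x + k].
Proof.
have g i : grid n (c %/ 4) + i%:R * 4 ^- n.+1 = grid n.+1 (c %/ 4 * 4 + i).
  by rewrite -(grid_refine n 1) addn1 /grid natrD mulrDl expn1.
have dE := divn_eq c 4; have r4 : (c %% 4 < 4)%N by rewrite ltn_mod.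
have [r2|r2] := ltnP (c %% 4) 2.
  exists (b n (c %/ 4))%:R, (- ((b n (c %/ 4))%:R * grid n (c %/ 4))).
  split=> [|x xc]; first by rewrite normr_nat.
  rewrite (tooth_cell (in_cell_parent xc)) min_l ?mulrBr//.
  have : grid n.+1 c.+1 <= grid n.+1 (c %/ 4 * 4 + 2) by rewrite le_grid; lia.
  by rewrite -g (gridS n (c %/ 4)) (exp4VS n); case/andP: xc => _; lra.
exists (- (b n (c %/ 4))%:R), ((b n (c %/ 4))%:R * grid n (c %/ 4).+1).
split=> [|x xc]; first by rewrite normrN normr_nat.
rewrite (tooth_cell (in_cell_parent xc)) min_r ?mulrBr 1?addrC ?mulNr//.
have : grid n.+1 (c %/ 4 * 4 + 2) <= grid n.+1 c by rewrite le_grid; lia.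
by rewrite -g (gridS n (c %/ 4)) (exp4VS n); case/andP: xc => + _; lra.
Qed.

(** * Partial sums of tents and their limit *)

Definition psum N x : R := \sum_(n < N) tooth n x.

Lemma psumS N x : psum N.+1 x = psum N x + tooth N x.
Proof. by rewrite /psum big_ord_recr. Qed.

Lemma psum_linear N c : exists s k : R,
  forall x, in_cell N c x -> psum N x = s * x + k.
Proof.
elim: N c => [|N IHN] c.
  by exists 0, 0 => x _; rewrite /psum big_ord0 mul0r addr0.
have [s [k so]] := IHN (c %/ 4)%N; have [s' [k' [_ so']]] := tooth_child N c.
exists (s + s'), (k + k') => x xc.
by rewrite psumS so 1?so'//; [ring|exact: in_cell_parent].
Qed.

(** The height bound [4 ^- n / 2] is at most [4 ^- n - 4 ^- n.+1], so the bounds telescope. *)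
Lemma psum_tail N i x : 0 <= x ->
  psum N x <= psum (N + i) x <= psum N x + 4 ^- N - 4 ^- (N + i).
Proof.
move=> x0; elim: i => [|i IHi]; first by rewrite addn0; lra.
have := tooth_bound (N + i) x0; move: IHi; rewrite addnS psumS.
by rewrite (exp4VS (N + i)); lra.
Qed.

(** The sum of the series of tents; on [x >= 0] the partial sums are nondecreasing, so the supremum
    is their limit. *)
Definition wave x : R := sup (range (psum ^~ x)).

Lemma wave_psum N x : 0 <= x -> psum N x <= wave x <= psum N x + 4 ^- N.
Proof.
move=> x0.
have ub M : ubound (range (psum ^~ x)) (psum M x + 4 ^- M).
  move=> _ [n _ <-]; have E := exp4V_gt0.
  have [Mn|/ltnW nM] := leqP M n.
    by have := psum_tail M (n - M) x0; rewrite subnKC//; have := E n; lra.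
  by have := psum_tail n (M - n) x0; rewrite subnKC//; have := E M; lra.
apply/andP; split; last by apply: ge_sup => //; exists (psum N x); exists N.
by apply: ub_le_sup; [exists (psum N x + 4 ^- N)|exists N].
Qed.

Lemma exp4V_lt (e : R) : 0 < e -> exists n, 4 ^- n < e.
Proof.
move=> /exp2V_lt[n ne]; exists n; apply: le_lt_trans ne.
rewrite exp4V_exp2V; have := exp2V_gt0 R n; have := @exp2V_le R 0 n isT.
by rewrite expr0 invr1; nra.
Qed.

Lemma wave_finite N x : 0 <= x -> (forall n, (N <= n)%N -> tooth n x = 0) ->
  wave x = psum N x.
Proof.
move=> x0 t0.
have E i : psum (N + i) x = psum N x.
  by elim: i => [|i IHi]; rewrite ?addn0// addnS psumS IHi t0 ?leq_addr ?addr0.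
have /andP[l _] := wave_psum N x0.
apply/eqP; rewrite eq_le l andbT leNgt; apply/negP => lt.
have [|n ne] := @exp4V_lt (wave x - psum N x); first by rewrite subr_gt0.
have := wave_psum (N + n) x0; rewrite E.
have : 4 ^- (N + n) <= 4 ^- n :> R.
  by rewrite lef_pV2 ?posrE ?exp4_gt0// ler_eXn2l ?ltr1n// leq_addl.
lra.
Qed.

(** A grid point of depth [N] is an end point of cells at every later depth, where tents vanish;
    values there are finite sums. *)
Lemma tooth_grid N c n : (N <= n)%N -> tooth n (grid N c) = 0.
Proof.
move=> Nn; rewrite -(grid_refine N (n - N)) subnKC//.
rewrite (@tooth_cell n (c * 4 ^ (n - N))); last by rewrite /in_cell lexx le_grid leqnSn.
by rewrite subrr min_l ?mulr0// subr_ge0 le_grid leqnSn.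
Qed.

Lemma grid_ge0 n c : 0 <= grid n c.
Proof. by rewrite divr_ge0 ?exprn_ge0. Qed.

Lemma wave_grid N c : wave (grid N c) = psum N (grid N c).
Proof. by apply: wave_finite; [exact: grid_ge0|move=> n; exact: tooth_grid]. Qed.

Lemma psum_lipschitz N x y : 0 <= x -> 0 <= y ->
  `|psum N x - psum N y| <= N%:R * `|x - y|.
Proof.
wlog xy : x y / x <= y => [H x0 y0|x0 y0].
  by have [/H|/ltW/H] := leP x y; [|rewrite distrC (distrC x)]; apply.
elim: N => [|N IHN]; first by rewrite /psum !big_ord0 subrr normr0 mul0r.
rewrite !psumS opprD addrACA -natr1 mulrDl mul1r (le_trans (ler_normD _ _))//.
by rewrite lerD// (distrC x) (ger0_norm (_ : 0 <= y - x)) ?subr_ge0// tooth_lipschitz ?x0.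
Qed.

(** The partial sum is [M]-Lipschitz and the tail is at most [4 ^- M]; the total
    [(2 * M + 1) * 4 ^- M] is at most [2 * 2 ^- M]. *)
Lemma wave_modulus M x y : 0 <= x -> 0 <= y -> `|x - y| <= 2 * 4 ^- M ->
  `|wave x - wave y| <= 2 * 2 ^- M.
Proof.
move=> x0 y0 xy.
have := wave_psum M x0; have := wave_psum M y0.
have : `|psum M x - psum M y| <= M%:R * (2 * 4 ^- M).
  by apply: le_trans (psum_lipschitz _ _ _) _ => //; rewrite ler_wpM2l.
have : (2 * M + 1)%:R <= 2 * 2 ^+ M :> R.
  rewrite -natrX -natrM ler_nat; have := ltn_expl M (isT : (1 < 2)%N); lia.
have := exp2V_gt0 R M; have := exp4V_gt0 M.
have : 2 ^+ M * 2 ^- M = 1 :> R by rewrite mulfV ?expf_neq0.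
rewrite exp4V_exp2V natrD natrM.
move: (2 ^+ M) (2 ^- M) => A B AB B20 B0 hM.
have : (2 * M%:R + 1) * (B * B) <= 2 * B.
  have -> : 2 * B = 2 * A * (B * B) by rewrite -mulrA (mulrA A) AB mul1r.
  by apply: ler_wpM2r; [exact: ltW|exact: hM].
by rewrite !ler_norml; lra.
Qed.

End Wave.

(** * The function attached to a null Pi02 set *)

Section Backward.
Variable R : realType.

Lemma cauchy_name_of_dist (q : nat -> rat) (x : R) :
  (forall n, `|ratr (q n) - x| <= 2 ^- n.+2) -> cauchy_name q x.
Proof.
move=> qx; split=> [n n0|].
  rewrite -(ler_rat R) ratr_exp2V ratr_norm rmorphB.
  have := qx n; have := qx n.-1; case: n n0 => // n _ /=.
  have := exp2V_gt0 R n.+3; rewrite (exp2VS R n.+1) (exp2VS R n.+2) !ler_norml; lra.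
apply/cvgrPdist_lt => e /exp2V_lt[N Ne]; exists N => // n /= Nn.
rewrite distrC; apply: le_lt_trans (qx n) _; apply: le_lt_trans Ne.
by apply: exp2V_le; lia.
Qed.

Section Construction.
Variables t p d q e : nat -> nat -> nat.
Hypotheses (ct : computable2 t) (cp : computable2 p) (cd : computable2 d)
  (cq : computable2 q) (ce : computable2 e).

Local Notation hit := (hit t p d q e).
Local Notation level := (level t p d q e).
Local Notation bet := (bet t p d q e).
Local Notation wave := (@wave R bet).
Local Notation psum := (@psum R bet).

Lemma wave_natE M j :
  wave (grid R M j) = (wave_nat t p d q e M j)%:R / 4 ^+ M.
Proof.
rewrite wave_grid /psum /wave_nat natr_sum mulr_suml; apply: eq_bigr => n _.
set D := (4 ^ (M - n))%N; set c := (j %/ D)%N.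
have D0 : (0 < D)%N by rewrite expn_gt0.
have gE i : grid R n i = grid R M (i * D).
  by rewrite -(grid_refine R n (M - n)) subnKC// ltnW.
have lo : (c * D <= j)%N by exact: leq_trunc_div.
have hi : (j <= c.+1 * D)%N by rewrite ltnW// ltn_ceil.
have gB u v : (v <= u)%N -> grid R M u - grid R M v = grid R M (u - v).
  by move=> vu; rewrite /grid natrB// mulrBl.
rewrite (@tooth_cell _ _ n c); last by rewrite /in_cell !gE !le_grid lo.
rewrite !gE !gB// natrM -mulrA; congr (_ * _).
have [le|lt] := leqP (j - c * D) (c.+1 * D - j).
  by rewrite min_l ?le_grid.
by rewrite min_r ?le_grid// ltnW.
Qed.

Lemma wave_computable : computable_fun01 wave.
Proof.
have in0 (x : R) : x \in `[0, 1] -> 0 <= x by rewrite in_itv => /andP[].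
split=> [x x01 cx|].
  have [||J cJ JE] := @computable_realseq_nat_approx R x 0 => //.
    by move=> k; rewrite addr0 in0.
  pose a k n := wave_nat t p d q e (n + 4) (J k (2 * (n + 4))%N).
  pose b (k n : nat) := (4 ^ (n + 4)).-1.
  exists (fun k n => (-1) ^+ 0 * (a k n)%:R / (b k n).+1%:R); split.
    exists (fun _ _ => 0%N), a, b; split=> //; apply/computable2P; rewrite /a /b;
      last (by rec_fun_tac); first by rec_fun_tac.
    by apply: rec_fun_wave_nat => //; rec_fun_tac.
  move=> k; apply: cauchy_name_of_dist => n.
  rewrite ratr_sgn_div expr0 mul1r /b prednK ?expn_gt0// natrX -wave_natE.
  set M := (n + 4)%N; set u := grid _ _ _.
  (* Precision [2 * M] puts [u] within [2 * 4 ^- M] of [x k], so the values differ by at most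
     [2 * 2 ^- M], that is [2 ^- n.+3]. The point [u] may exceed 1, which the modulus on all
     nonnegative reals allows. *)
  have : `|wave u - wave (x k)| <= 2 * 2 ^- M.
    apply: wave_modulus; [exact: grid_ge0|exact: in0|].
    have := JE k (2 * M)%N; rewrite addr0 exprM.
    have -> : 2 ^+ 2 = 4 :> R by ring.
    have -> : u - x k = ((J k (2 * M)%N)%:R - 4 ^+ M * x k) / 4 ^+ M.
      by rewrite /u /grid; field; rewrite expf_neq0.
    rewrite normrM normfV (gtr0_norm (exp4_gt0 R M)) => h.
    by rewrite ler_wpM2r// invr_ge0 ltW// exp4_gt0.
  have := exp2V_gt0 R M; rewrite /M addn4.
  by rewrite (exp2VS R n.+2) (exp2VS R n.+3); lra.
exists (fun n => 2 * (n + 2))%N.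
  by apply/computable1P; rec_fun_tac.
move=> n x y x01 y01 xy.
have : `|wave x - wave y| <= 2 * 2 ^- (n + 2).
  apply: wave_modulus; [exact: in0|exact: in0|].
  move: xy; rewrite exprM; have -> : 2 ^+ 2 = 4 :> R by ring.
  by have := exp4V_gt0 R (n + 2); lra.
have := exp2V_gt0 R (n + 2); rewrite addn2.
by rewrite (exp2VS R n) (exp2VS R n.+1); lra.
Qed.

(** * Soundness and completeness of the containment test *)

Section Interval.
Variables (t0 p0 d0 q0 e0 : nat).
Local Notation I := (open_interval01 t0 (dyadic R p0 d0) (dyadic R q0 e0)).

Lemma cell_test_loE n c : (p0 * 4 ^ n + 2 ^ d0 * 2 ^ n < c * 2 ^ d0)%N =
  (dyadic R p0 d0 + 2 ^- n < grid R n c).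
Proof.
have D0 : 0 < 2 ^+ d0 :> R by rewrite exprn_gt0.
have N0 : 0 < 2 ^+ n :> R by rewrite exprn_gt0.
rewrite -(ltr_nat R) natrD !natrM !natrX /dyadic /grid.
have -> : 4 ^+ n = 2 ^+ n * 2 ^+ n :> R.
  by rewrite -exprMn_comm//; congr (_ ^+ _); ring.
move: (2 ^+ d0) (2 ^+ n) D0 N0 => D N D0 N0.
have P : 0 < D * (N * N) by rewrite !mulr_gt0.
rewrite -[RHS](ltr_pM2l P) -subr_gt0 -[RHS]subr_gt0; congr (0 < _); field.
by rewrite !gt_eqF.
Qed.

Lemma cell_test_hiE n c : ((c.+1 + 2 ^ n) * 2 ^ e0 < q0 * 4 ^ n)%N =
  (grid R n c.+1 + 2 ^- n < dyadic R q0 e0).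
Proof.
have D0 : 0 < 2 ^+ e0 :> R by rewrite exprn_gt0.
have N0 : 0 < 2 ^+ n :> R by rewrite exprn_gt0.
rewrite -(ltr_nat R) !natrM natrD !natrX /dyadic /grid.
have -> : 4 ^+ n = 2 ^+ n * 2 ^+ n :> R.
  by rewrite -exprMn_comm//; congr (_ ^+ _); ring.
move: (2 ^+ e0) (2 ^+ n) (c.+1%:R) D0 N0 => D N C D0 N0.
have P : 0 < D * (N * N) by rewrite !mulr_gt0.
rewrite -[RHS](ltr_pM2l P) -subr_gt0 -[RHS]subr_gt0; congr (0 < _); field.
by rewrite !gt_eqF.
Qed.

Lemma cell_test_sound n c (x : R) : cell_test t0 p0 d0 q0 e0 n c ->
  0 <= x <= 1 -> grid R n c - 2 ^- n <= x <= grid R n c.+1 + 2 ^- n -> I x.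
Proof.
rewrite /cell_test cell_test_loE cell_test_hiE => h x01 xc.
by case: t0 h => [|[|[|n']]] /=; rewrite in_itv /=; lra.
Qed.

(** The fattened cell stays within [2 ^- n + 4 ^- n <= 2 * 2 ^- n] of [x], hence eventually inside
    an interval that is open in [[0, 1]]. *)
Lemma cell_test_complete c (x : R) : 0 <= x <= 1 -> (forall n, in_cell n (c n) x) ->
  I x -> exists N, forall n, (N <= n)%N -> cell_test t0 p0 d0 q0 e0 n (c n).
Proof.
move=> x01 xc xI.
have lo : dyadic R p0 d0 < x -> exists N, forall n, (N <= n)%N ->
    dyadic R p0 d0 + 2 ^- n < grid R n (c n).
  rewrite -subr_gt0 => h.
  have [|N hN] := @exp2V_lt R ((x - dyadic R p0 d0) / 2); first lra.
  exists N => n Nn; have := @exp2V_le R _ _ Nn; have /andP[_] := xc n.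
  rewrite gridS exp4V_exp2V; have := @exp2V_le R 0 n isT; have := exp2V_gt0 R n.
  by rewrite expr0 invr1; nra.
have hi : x < dyadic R q0 e0 -> exists N, forall n, (N <= n)%N ->
    grid R n (c n).+1 + 2 ^- n < dyadic R q0 e0.
  rewrite -subr_gt0 => h.
  have [|N hN] := @exp2V_lt R ((dyadic R q0 e0 - x) / 2); first lra.
  exists N => n Nn; have := @exp2V_le R _ _ Nn; have /andP[+ _] := xc n.
  rewrite gridS exp4V_exp2V; have := @exp2V_le R 0 n isT; have := exp2V_gt0 R n.
  by rewrite expr0 invr1; nra.
rewrite /cell_test.
case: t0 xI => [|[|[|n']]] /=; rewrite in_itv /=.
- move=> /andP[/lo[N hN] /hi[N' hN']]; exists (maxn N N') => n.
  by rewrite geq_max cell_test_loE cell_test_hiE => /andP[/hN-> /hN'->].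
- by move=> /andP[_ /hi[N hN]]; exists N => n; rewrite cell_test_hiE; exact: hN.
- by move=> /andP[/lo[N hN] _]; exists N => n; rewrite cell_test_loE andbT; exact: hN.
- by move=> _; exists 0%N.
Qed.

End Interval.

Let G m : set R := \bigcup_k open_interval01 (t m k)
          (dyadic R (p m k) (d m k)) (dyadic R (q m k) (e m k)).

Lemma hit_sound m n c (x : R) : hit m n c -> 0 <= x <= 1 ->
  grid R n c - 2 ^- n <= x <= grid R n c.+1 + 2 ^- n -> G m x.
Proof.
by move=> /existsP[k hk] x01 xc; exists k => //; exact: cell_test_sound hk _ _.
Qed.

(** Without a later bet the level would stay constant, and an interval of that level containing [x]
    would be detected at some larger depth. *)
Lemma bet_recurs c (x : R) N : path4 c -> 0 <= x <= 1 ->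
  (forall n, in_cell n (c n) x) -> G (level N (c N)) x ->
  exists2 n, (N <= n)%N & bet n (c n).
Proof.
move=> pc x01 xc [k _ /(cell_test_complete x01 xc)[N' hN']].
apply: contrapT => nb.
have {}nb n : (N <= n)%N -> ~~ bet n (c n).
  by move=> Nn; apply/negP => bn; apply: nb; exists n.
(* The bound [k.+1] ensures that interval [k] is among those inspected at depth [n]. *)
pose n := maxn N (maxn N' k.+1).
have Nn : (N <= n)%N by rewrite leq_maxl.
have := nb n Nn; rewrite /bet (level_path_const pc Nn) => [/negP|i /andP[Ni _]].
  apply; have kn : (k < n)%N by rewrite /n !leq_max leqnn !orbT.
  apply/existsP; exists (Ordinal kn) => /=; apply: hN'.
  by rewrite /n !leq_max leqnn !orbT.
exact: nb.
Qed.

(** At both ends of the cell the wave equals [psum n], which is affine on the cell. *)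
Lemma wave_chord n c : exists2 s : R,
  slope wave (grid R n c) (grid R n c.+1) = s &
  exists k, forall x, in_cell n c x -> psum n x = s * x + k.
Proof.
have [s [k sk]] := psum_linear R bet n c; exists s; last by exists k.
have lt : grid R n c < grid R n c.+1 by rewrite lt_grid.
rewrite /slope !wave_grid !sk ?/in_cell ?lexx ?(ltW lt)//.
by field; rewrite gt_eqF// subr_gt0.
Qed.

Lemma wave_chord_bet n c : bet n (c %/ 4) ->
  `|slope wave (grid R n.+1 c) (grid R n.+1 c.+1) -
    slope wave (grid R n (c %/ 4)) (grid R n (c %/ 4).+1)| = 1.
Proof.
move=> bn; have [s -> [k sk]] := wave_chord n (c %/ 4).
have [s1 -> [k1 sk1]] := wave_chord n.+1 c.
have [s' [k' [<- sk']]] : exists s k : R, [/\ `|s| = 1 &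
    forall x, in_cell n.+1 c x -> tooth bet n x = s * x + k].
  by have := @tooth_child R bet n c; rewrite bn.
congr `|_|.
have lt : grid R n.+1 c < grid R n.+1 c.+1 by rewrite lt_grid.
have E x : in_cell n.+1 c x -> s1 * x + k1 = s * x + k + (s' * x + k').
  by move=> xc; rewrite -sk1// psumS sk ?sk'//; exact: in_cell_parent.
have := E (grid R n.+1 c); have := E (grid R n.+1 c.+1).
rewrite /in_cell lexx ltW//= lexx => /(_ isT) E1 /(_ isT) E2.
apply: (@mulIf _ (grid R n.+1 c.+1 - grid R n.+1 c)); first by rewrite gt_eqF// subr_gt0.
by move: E1 E2; lra.
Qed.

Lemma wave_not_differentiable (z : R) : z \in `[0, 1] -> (forall m, G m z) ->
  ~ differentiable01 wave z.
Proof.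
rewrite in_itv /= => /andP[z0 z1] zG /differentiable01P[l /differentiable01_chord hl].
(* For [z = 1] the last cells in [[0, 1]] are used, as [cell] would select cells beyond 1. *)
have [c [pc zc c4]] : exists c, [/\ path4 c, forall n, in_cell n (c n) z &
    forall n, (c n < 4 ^ n)%N].
  move: z1; rewrite le_eqVlt => /predU1P[->|z1].
    exists (fun n => (4 ^ n).-1); split=> n; last by rewrite prednK ?expn_gt0.
      rewrite expnS; have : (0 < 4 ^ n)%N by rewrite expn_gt0.
      lia.
    rewrite /in_cell prednK ?expn_gt0// /grid natrX mulfV ?expf_neq0// lexx andbT.
    by rewrite ler_pdivrMr ?exprn_gt0// mul1r -natrX ler_nat leq_pred.
  exists (fun n => cell n z); split=> [|n|n]; [exact: cell_path|exact: cell_in|].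
  rewrite -(@lt_grid R n); apply: le_lt_trans (_ : z < _).
    by have /andP[] := cell_itv n z0.
  by rewrite /grid natrX mulfV ?expf_neq0.
(* Slopes within 1/4 of [l] differ by at most 1/2, whereas a bet changes the slope by 1. *)
have [D D0 hD] := hl 4^-1 ltac:(lra).
have [N ND] := exp4V_lt D0.
have z01 : 0 <= z <= 1 by rewrite z0.
have [n Nn bn] := bet_recurs pc z01 zc (zG (level N (c N))).
have chord i : (N <= i)%N ->
    `|slope wave (grid R i (c i)) (grid R i (c i).+1) - l| <= 4^-1.
  move=> Ni.
  have g01 j : (j <= 4 ^ i)%N -> grid R i j \in `[0, 1].
    move=> j4; rewrite in_itv /= grid_ge0 /=.
    by rewrite /grid ler_pdivrMr ?exprn_gt0// mul1r -natrX ler_nat.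
  apply: hD; [exact/g01/ltnW|exact: g01|exact: zc|by rewrite lt_grid|].
  rewrite gridS addrC addKr; apply: le_lt_trans ND.
  by rewrite lef_pV2 ?posrE ?exp4_gt0// ler_eXn2l ?ltr1n.
have := chord n Nn; have := chord n.+1 (leq_trans Nn (leqnSn n)).
have := @wave_chord_bet n (c n.+1); rewrite pc bn => /(_ isT).
move: (slope _ _ _) (slope _ _ _) => s1 s2 s12 h1 h2.
have : `|s2 - s1| <= 2^-1 by move: h1 h2; rewrite !ler_norml; lra.
by rewrite s12; lra.
Qed.

Lemma wave_differentiable (x : R) : x \in `[0, 1] -> (forall n c, x != grid R n c) ->
  ~ (forall m, G m x) -> differentiable01 wave x.
Proof.
rewrite in_itv /= => /andP[x0 x1] xg /existsNP[m xm].
have x01 : 0 <= x <= 1 by rewrite x0.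
have pc := cell_path x0; pose c n := cell n x; rewrite -/c in pc.
have xc n : in_cell n (c n) x by exact: cell_in.
(* Infinitely many bets would push the level past [m], so some cell containing [x] would have been
   hit for [m], putting [x] in [G m]. *)
have [N nb] : exists N, forall n, (N <= n)%N -> ~~ bet n (c n).
  apply: contrapT => hN; have {}hN N : exists2 n, (N <= n)%N & bet n (c n).
    apply: contrapT => nb; apply: hN; exists N => n Nn; apply/negP => bn.
    by apply: nb; exists n.
  have [n mn] := bets_level_unbounded pc hN m.+1.
  have [n' hn'] := level_path_hit pc mn.
  apply: xm; apply: (hit_sound hn') => //.
  by have := xc n'; rewrite /in_cell; have := exp2V_gt0 R n'; lra.
have xG : ~ G (level N (c N)) x.
  by move=> /(bet_recurs pc x01 xc)[n /nb /negbTE ->].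
have tooth0 y n : ~~ bet n (cell n y) -> tooth bet n y = 0.
  by rewrite /tooth => /negbTE->; rewrite mul0r.
have wx : wave x = psum N x.
  by apply: wave_finite => // n Nn; apply: tooth0; exact: nb.
have [s [k sk]] := psum_linear R bet N (c N).
have quad y : grid R N (c N) <= y < grid R N (c N).+1 ->
    0 <= wave y - psum N y <= `|y - x| ^+ 2.
  move=> yc; have y0 : 0 <= y by apply: le_trans (grid_ge0 R N (c N)) _; case/andP: yc.
  have pcy := cell_path y0.
  have cN : cell N y = c N by exact: cell_unique.
  have [hb|nby] := pselect (exists n, (N <= n)%N && bet n (cell n y)); last first.
    rewrite (@wave_finite _ _ N)// => [|n Nn]; first by rewrite subrr lexx exprn_ge0.
    by apply: tooth0; apply/negP => bn; apply: nby; exists n; rewrite Nn.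
  case: (ex_minnP hb) => n /andP[Nn bn] nmin.
  have nb' i : (N <= i < n)%N -> ~~ bet i (cell i y).
    move=> /andP[Ni lin]; apply/negP => bi; move: (nmin i).
    by rewrite Ni bi => /(_ isT); rewrite leqNgt lin.
  have psE : psum n y = psum N y.
    rewrite -(subnKC Nn); have : (N + (n - N) <= n)%N by rewrite subnKC.
    elim: (n - N)%N => [|i IHi]; first by rewrite addn0.
    rewrite addnS => lin; rewrite psumS IHi 1?ltnW// tooth0 ?addr0//.
    by apply: nb'; rewrite leq_addr.
  (* At the first bet above [y] from depth [N] on, the level is still that of [x] at depth [N]. Were
     [x] nearer, it would lie in the fattened cell, hence in [G] of that level, against [xG]. *)
  have far : 2 ^- n <= `|y - x|.
    rewrite leNgt; apply/negP; rewrite ltr_norml => near_.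
    apply: xG; have := bn; rewrite /bet (level_path_const pcy Nn)// cN => hn.
    apply: (hit_sound hn) => //.
    by have := cell_in n y0; rewrite /in_cell; lra.
  have := wave_psum bet n y0; rewrite psE exp4V_exp2V.
  have : 2 ^- n * 2 ^- n <= `|y - x| ^+ 2.
    by rewrite expr2 ler_pM// ltW// exp2V_gt0.
  by lra.
apply/differentiable01P; exists s => ep ep0.
have xl : grid R N (c N) < x.
  by rewrite lt_neqAle eq_sym xg; case/andP: (xc N).
have xr : x < grid R N (c N).+1.
  by rewrite lt_neqAle xg; case/andP: (xc N).
exists (Num.min ep (Num.min (x - grid R N (c N)) (grid R N (c N).+1 - x))).
  by rewrite !lt_min ep0 !subr_gt0 xl xr.
move=> y y01 yx; rewrite !lt_min => /andP[ye /andP[yl yr]].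
have yc : grid R N (c N) <= y < grid R N (c N).+1.
  by move: yl yr; rewrite !ltr_norml; lra.
have yx0 : y - x != 0 by rewrite subr_eq0.
have -> : (wave y - wave x) / (y - x) - s = (wave y - psum N y) / (y - x).
  rewrite wx (sk x (xc N)) (sk y) ?/in_cell; last by case/andP: yc => -> /ltW.
  by field.
have := quad y yc; have yxp : 0 < `|y - x| by rewrite normr_gt0.
rewrite normrM normfV ler_pdivrMr// => /andP[w0 w1]; rewrite ger0_norm//.
by apply: le_trans w1 _; rewrite expr2 ler_wpM2r// ltW.
Qed.

End Construction.

Lemma differentiable_weakly2random (z : R) : z \in `[0, 1] ->
  (forall f : R -> R, computable_fun01 f ->
     {ae lebesgue_measure, forall x : R, x \in `[0, 1] -> differentiable01 f x} ->
     differentiable01 f z) -> weakly2random z.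
Proof.
move=> z01 zd; split=> // S PS S0 Sz.
have [G [t [p [d [q [e [[ct cp cd cq ce] _ GE]]]]]] SE] := PS.
have SG x : S x <-> forall m, (\bigcup_k open_interval01 (t m k)
          (dyadic R (p m k) (d m k)) (dyadic R (q m k) (e m k))) x.
  rewrite SE; split=> [xS m|xS m _]; first by rewrite -GE; exact: xS.
  by rewrite GE; exact: xS.
apply: (wave_not_differentiable z01 ((SG z).1 Sz)).
apply: zd; first exact: wave_computable.
(* At 4-adic points tents may leave corners; there are only countably many such points. *)
pose Q := [set x | exists n c, x = grid R n c].
have cQ : countable Q.
  have : countable (range (fun nc : nat * nat => grid R nc.1 nc.2)).
    by apply: card_le_trans (card_image_le _ _) _; exact: countableP.
  by apply: sub_countable; apply: subset_card_le => x [n [c ->]]; exists (n, c).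
have QN : lebesgue_measure.-negligible Q.
  apply/negligibleP; last exact: countable_lebesgue_measure0.
  exact: countable_measurable.
have SN : lebesgue_measure.-negligible S.
  by apply/negligibleP => //; exact: measurable_Pi02.
apply: negligibleS (negligibleU SN QN) => x /=.
move=> /not_implyP[xin nd]; apply: contrapT => /not_orP[xS xQ]; apply: nd.
apply: wave_differentiable => //.
  by move=> n c; apply/eqP => xE; apply: xQ; exists n, c.
by move=> h; apply/xS/SG.
Qed.

End Backward.

Theorem theorem5p1 (R : realType) (z : R) (hz : z \in `[0, 1]) :
  weakly2random z <->
  (forall f : R -> R, computable_fun01 f ->
     {ae lebesgue_measure, forall x : R, x \in `[0, 1] -> differentiable01 f x} ->
     differentiable01 f z).
Proof.
split=> [zr f cf aef|]; first exact: weakly2random_differentiable.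
exact: differentiable_weakly2random.
Qed.
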